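(* There exists an absolute constant $C>0$ such that the following holds for every $n\geq 1$. Let $\{P_i : i\in I\}$ be a family of closed half-spaces $$P_i=\{x\in\mathbb{R}^n : \langle x,v_i\rangle\leq 1\},\qquad v_i\in\mathbb{R}^n,$$ in $\mathbb{R}^n$ such that $P=\bigcap_{i\in I}P_i$ has positive volume. For every real $d>1$ there exist $s\leq (d+1)(n+1)$ and $i_1,\ldots,i_s\in I$ such that $$|P_{i_1}\cap\cdots\cap P_{i_s}|\leq\gamma_d^{\frac{n+1}{2}}\,\frac{n^{n/2}(n+1)^{3(n+1)/2}}{\pi^{\frac{n}{2}}\,n!}\,\Gamma\left(\frac{n}{2}+1\right)|P|\leq\gamma_d^{\frac{n+1}{2}}(Cn)^{\frac{3n}{2}}|P|,$$ where $\gamma_d:=\left(\frac{\sqrt{d}+1}{\sqrt{d}-1}\right)^2$.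
   Context: $|\cdot|$ denotes $n$-dimensional volume (Lebesgue measure) in $\mathbb{R}^n$, with values in $[0,+\infty]$; $\langle\cdot,\cdot\rangle$ is the Euclidean inner product; $\Gamma$ is the Gamma function; $s$ is an integer. The family may be infinite. ''Absolute constant'' means a constant independent of $n$, $d$ and the family. *)

(* Defs.v *)
From HB Require Import structures.
From mathcomp Require Import all_boot all_order all_algebra.
From mathcomp Require Import all_classical all_reals all_analysis.

Set Implicit Arguments.
Unset Strict Implicit.
Unset Printing Implicit Defensive.

Import Order.TTheory GRing.Theory Num.Theory.
Import numFieldNormedType.Exports.

Local Open Scope classical_set_scope.
Local Open Scope ring_scope.

Section lebesgue_tuple.
Variable R : realType.

Definition tuple_cons n (p : measurableTypeR R * n.-tuple (measurableTypeR R)) :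
  n.+1.-tuple (measurableTypeR R) := [tuple of p.1 :: p.2].

Definition tuple_product n (mu : set (n.-tuple (measurableTypeR R)) -> \bar R) :
  set (n.+1.-tuple (measurableTypeR R)) -> \bar R :=
  pushforward (lebesgue_measure \x mu)%E (@tuple_cons n).

(* The library has no n-dimensional Lebesgue measure: this is the n-fold
   product of the one-dimensional one, carried by the product sigma-algebra of
   n.-tuple; see [lebesgue_tuple_box] below for its values on boxes. *)
Fixpoint lebesgue_tuple n : set (n.-tuple (measurableTypeR R)) -> \bar R :=
  match n with
  | 0 => \d_[tuple]
  | n'.+1 => tuple_product (lebesgue_tuple (n := n'))
  end.

Lemma measurable_tuple_cons n : measurable_fun setT (@tuple_cons n).
Proof.
exact: (@measurable_cons _ _ _ _ fst n snd measurable_fst measurable_snd).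
Qed.

Definition tuple_uncons n (t : n.+1.-tuple (measurableTypeR R)) :
  measurableTypeR R * n.-tuple (measurableTypeR R) :=
  (thead t, [tuple of behead t]).

Lemma measurable_tuple_uncons n : measurable_fun setT (@tuple_uncons n).
Proof.
apply/measurable_fun_pairP; split; first exact: measurable_tnth.
exact: measurable_behead.
Qed.

Lemma tuple_consK n : cancel (@tuple_cons n) (@tuple_uncons n).
Proof.
by move=> [x t]; rewrite /tuple_uncons /tuple_cons/= theadE; congr pair;
  exact: val_inj.
Qed.

Lemma measurable_tuple_uncons_preimage n
    (A : set (measurableTypeR R * n.-tuple (measurableTypeR R))) :
  measurable A -> measurable (@tuple_uncons n @^-1` A).
Proof.
by move=> mA; rewrite -[X in measurable X]setTI; exact: measurable_tuple_uncons.
Qed.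

Lemma tuple_cons_preimageK n
    (A : set (measurableTypeR R * n.-tuple (measurableTypeR R))) :
  @tuple_cons n @^-1` (@tuple_uncons n @^-1` A) = A.
Proof. by apply/seteqP; split=> p /=; rewrite tuple_consK. Qed.

Section tuple_product.
Variables (n : nat)
  (mu : {sigma_finite_measure set (n.-tuple (measurableTypeR R)) -> \bar R}).

Let m := tuple_product mu.

Let m0 : m set0 = 0%E.
Proof. by rewrite /m /tuple_product /pushforward preimage_set0 measure0. Qed.

Let m_ge0 A : (0 <= m A)%E.
Proof. by rewrite /m /tuple_product /pushforward. Qed.

Let m_additive : semi_sigma_additive m.
Proof.
have mpre A : measurable A -> measurable (@tuple_cons n @^-1` A).
  by move=> mA; rewrite -[X in measurable X]setTI; exact: measurable_tuple_cons.
move=> F mF tF mUF; rewrite /m /tuple_product /pushforward preimage_bigcup.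
apply: (@measure_semi_sigma_additive _ _ _ (lebesgue_measure \x mu)%E).
- by move=> k; exact: mpre.
- apply/trivIsetP => i j _ _ ij; rewrite -preimage_setI.
  by move/trivIsetP : tF => /(_ _ _ _ _ ij) ->//; rewrite preimage_set0.
- by rewrite -preimage_bigcup; exact: mpre.
Qed.

HB.instance Definition _ := isMeasure.Build _ _ _ (tuple_product mu)
  m0 m_ge0 m_additive.

Let m_sigma_finite : sigma_finite setT m.
Proof.
have /sigma_finiteP[F [FT ndF Foo]] := sigma_finiteT (@lebesgue_measure R).
have /sigma_finiteP[G [GT ndG Goo]] := sigma_finiteT mu.
exists (fun k => @tuple_uncons n @^-1` (F k `*` G k)).
  rewrite -preimage_bigcup (_ : \bigcup_k _ = setT) ?preimage_setT//.
  apply/seteqP; split=> // -[x t] _.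
  have [i _ Fix] : (\bigcup_i F i) x by rewrite -FT.
  have [j _ Gjt] : (\bigcup_j G j) t by rewrite -GT.
  exists (maxn i j) => //; split=> /=.
    by move: x Fix; exact/subsetPset/ndF/leq_maxl.
  by move: t Gjt; exact/subsetPset/ndG/leq_maxr.
move=> k; have [mF Fk] := Foo k; have [mG Gk] := Goo k; split.
  by apply: measurable_tuple_uncons_preimage; exact: measurableX.
rewrite /m /tuple_product /pushforward tuple_cons_preimageK product_measure1E//.
by rewrite lte_mul_pinfty// ge0_fin_numE.
Qed.

HB.instance Definition _ := Measure_isSigmaFinite.Build _ _ _
  (tuple_product mu) m_sigma_finite.

End tuple_product.

Lemma lebesgue_tuple_sigma_finite_measure n :
  {mu : {sigma_finite_measure set (n.-tuple (measurableTypeR R)) -> \bar R} |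
    lebesgue_tuple (n := n) = mu}.
Proof.
elim: n => [|n [mu muE]]; first by exists \d_[tuple].
by exists (tuple_product mu : {sigma_finite_measure set _ -> \bar R}); rewrite /= muE.
Qed.

Section lebesgue_tuple_measure.
Variable n : nat.
Let mu : set (n.-tuple (measurableTypeR R)) -> \bar R := @lebesgue_tuple n.

Let mu0 : mu set0 = 0%E.
Proof.
rewrite /mu; have [nu ->] := lebesgue_tuple_sigma_finite_measure n.
exact: measure0.
Qed.

Let mu_ge0 A : (0 <= mu A)%E.
Proof.
rewrite /mu; have [nu ->] := lebesgue_tuple_sigma_finite_measure n.
exact: measure_ge0.
Qed.

Let mu_additive : semi_sigma_additive mu.
Proof.
rewrite /mu; have [nu ->] := lebesgue_tuple_sigma_finite_measure n.
exact: measure_semi_sigma_additive.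
Qed.

Let mu_sigma_finite : sigma_finite setT mu.
Proof.
rewrite /mu; have [nu ->] := lebesgue_tuple_sigma_finite_measure n.
exact: sigma_finiteT.
Qed.

HB.instance Definition _ := isMeasure.Build _ _ _ (@lebesgue_tuple n)
  mu0 mu_ge0 mu_additive.

HB.instance Definition _ := Measure_isSigmaFinite.Build _ _ _
  (@lebesgue_tuple n) mu_sigma_finite.

End lebesgue_tuple_measure.

Lemma lebesgue_tuple_box n (A : 'I_n -> set (measurableTypeR R)) :
  (forall i, measurable (A i)) ->
  lebesgue_tuple [set t : n.-tuple (measurableTypeR R) |
                   forall i, A i (tnth t i)] =
  (\prod_(i < n) lebesgue_measure (A i))%E.
Proof.
elim: n => [|n IHn] in A * => mA.
  rewrite big_ord0 /= (_ : mkset _ = setT) ?diracT//.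
  by apply/seteqP; split=> // t _ [].
rewrite big_ord_recl -IHn//= -product_measure1E//; last first.
  rewrite (_ : mkset _ = \bigcap_(i in [set: 'I_n])
      (fun t : n.-tuple _ => tnth t i) @^-1` A (lift ord0 i)); last first.
    by apply/seteqP; split=> [t At i _|t At i]; exact: At.
  apply: fin_bigcap_measurable => // i _; rewrite -[X in measurable X]setTI.
  exact: measurable_tnth.
rewrite /tuple_product /pushforward; congr (_ _).
apply/seteqP; split=> [[x t] /= At|[x t] [/= Ax At] i].
  split=> [|i] /=; first exact: (At ord0).
  by have := At (lift ord0 i); rewrite tnthS.
case: (unliftP ord0 i) => [j|] ->; last by [].
by rewrite tnthS; exact: At.
Qed.

End lebesgue_tuple.

Section volume.
Variable R : realType.

Definition volume n (A : set 'rV[R]_n) : \bar R :=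
  lebesgue_tuple [set t : n.-tuple (measurableTypeR R) |
                   A (\row_(i < n) tnth t i)].

Definition dot n (x y : 'rV[R]_n) : R := \sum_(i < n) x 0 i * y 0 i.

Definition halfspace n (v : 'rV[R]_n) : set 'rV[R]_n :=
  [set x | dot x v <= 1].

(* Meaningful for x > 0, where the integral is finite. *)
Definition Gamma (x : R) : R :=
  \int[lebesgue_measure]_(t in `]0, +oo[) (t `^ (x - 1) * expR (- t)).

Definition gammad (d : R) : R :=
  ((Num.sqrt d + 1) / (Num.sqrt d - 1)) ^+ 2.

End volume.

(* Main.v *)
(* By continuity of the measure from above, a countable dense subfamily contains
   a finite one whose intersection is bounded and of volume at most
   gamma_d^((n+1)/2) |P|: if no finite intersection were bounded, P would be
   invariant under translation by a recession direction, so of volume 0 or +oo.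

   For a finite bounded family, put the polytope in John position: it contains
   the unit ball and there are unit normals u_j and weights c_j of sum 1 with
   sum c_j u_j = 0 and sum c_j u_j (x) u_j = Id/n.  For n independent indices
   drawn with the weights c_j, D the determinant of the drawn normals and s the
   norm of their sum, E D^2 = n!/n^n and E D^2 s^2 <= n E D^2, so some choice has
   D^2 >= n!/(2 n^n) and s^2 <= 2n.  Minus the sum of these n normals is a
   nonnegative combination of total mass n s of n+1 further ones, by
   Caratheodory; hence the intersection of these 2n+1 half-spaces is contained
   in a simplex of volume (n(1+s))^n/(n! D), which is compared with the volume
   pi^(n/2)/Gamma(n/2+1) of the unit ball. *)
Require Import Defs.
From HB Require Import structures.
From mathcomp Require Import all_boot all_order all_algebra.
From mathcomp Require Import fingroup perm.
From mathcomp Require Import all_classical all_reals all_analysis.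
From mathcomp Require Import measurable_realfun.
From mathcomp Require Import ring lra zify.

Set Implicit Arguments.
Unset Strict Implicit.
Unset Printing Implicit Defensive.

Import Order.TTheory GRing.Theory Num.Theory.
Import numFieldNormedType.Exports.

Local Open Scope classical_set_scope.
Local Open Scope ring_scope.

(** * Linear changes of variables *)

(** The finite case holds without any factor depending on d: the hypothesis d > 1 gives [gammad d] >
    1, which is the room spent on replacing the family by a finite one, and 2n + 1 <= 2(n + 1) <= (d
    + 1)(n + 1).

    The selection has to control two quantities at once, since the simplex has volume (n(1 + s))^n /
    (n! D). The trivial bound s <= n would exceed the stated constant by an exponential factor for
    large n, and a draw chosen for its determinant alone says nothing better about s. So D^2 serves
    as a density: with it the drawn normals repel each other in the mean, and s^2 keeps mean at most
    n, the value for independent centered unit vectors. The bounds n!/(2 n^n) and 2n each give away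
    a factor 2 to be met simultaneously.

    The volume of the ball and the finiteness of the Gamma integral both come from computing the
    Gaussian integral twice, by coordinates and by level sets. *)

Section affine_line.
Variable R : realType.
Local Notation mu := (@lebesgue_measure R).

Lemma measurable_affine (a b : R) :
  measurable_fun setT (fun x : measurableTypeR R => a * x + b : measurableTypeR R).
Proof. by apply: measurable_funD => //; exact: measurable_funM. Qed.

(** For a positive factor both sides are measures that agree on half-open intervals, so uniqueness
    of the Lebesgue measure applies. A negative factor is reduced to it by the reflection x |-> -
    x. *)
Lemma lebesgue_measure_affine (a b : R) (A : set (measurableTypeR R)) :
  a != 0 -> measurable A ->
  mu A = (`|a|%:E * mu [set x | A (a * x + b)%R])%E.
Proof.
have pos (c : R) (B : set (measurableTypeR R)) : 0 < c -> measurable B ->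
    mu B = (c%:E * mu [set x | B (c * x + b)%R])%E.
  move=> c0 mB.
  pose phi := fun x : measurableTypeR R => c * x + b : measurableTypeR R.
  have mphi : measurable_fun setT phi by exact: measurable_affine.
  pose k : {nonneg R} := NngNum (ltW c0).
  suff : mu B = (c%:E * mu (phi @^-1` B))%E by [].
  have U := @lebesgue_measure_unique R (mscale k (pushforward mu phi)).
  apply: (U mphi) => // _ [[u v]] _ <-.
  change (mu `]u, v]%classic = (c%:E * mu (phi @^-1` `]u, v]%classic))%E).
  have -> : phi @^-1` `]u, v]%classic = `](u - b) / c, (v - b) / c]%classic.
      apply/seteqP; split=> x /=; rewrite !in_itv/= ltr_pdivrMr// ler_pdivlMr//;
        by rewrite ltrBlDr lerBrDr mulrC.
    rewrite !lebesgue_measure_itv/= !lte_fin ltr_pM2r ?invr_gt0// ltrD2r.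
    case: ifP => _; last by rewrite mule0.
    rewrite -!EFinD -EFinM; congr EFin.
    by rewrite -mulrBl mulrC divfK ?gt_eqF//; ring.
case: (ltgtP a 0) => // a0 _ mA; last by rewrite gtr0_norm// (pos a A).
have mB : measurable [set x | A (a * x + b)].
  by rewrite -[X in measurable X]setTI; exact: (measurable_affine a b).
rewrite ltr0_norm// (pos (- a) A) ?oppr_gt0//; congr (_ * _)%E.
rewrite -(lebesgue_measureN mB); congr (mu _).
by apply/seteqP; split=> x /=; rewrite mulrN mulNr.
Qed.

End affine_line.

Section rows.
Variable R : realType.

Definition row_of_tuple n (t : n.-tuple (measurableTypeR R)) : 'rV[R]_n :=
  \row_(i < n) tnth t i.

(** [volume] is computed on tuples, so measurability of a set of rows is read there as well. *)
Definition rmeasurable n (A : set 'rV[R]_n) := measurable (@row_of_tuple n @^-1` A).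

Lemma row_of_tuple_cons n x (t : n.-tuple (measurableTypeR R)) :
  row_of_tuple (tuple_cons (x, t)) = row_mx x%:M (row_of_tuple t) :> 'rV_(1 + n).
Proof.
apply/rowP => i; rewrite !mxE; case: splitP => j ij.
  have -> : i = ord0 :> 'I_n.+1 by apply: val_inj; rewrite /= ij ord1.
  by rewrite ord1 !mxE eqxx.
have -> : i = lift ord0 j :> 'I_n.+1 by apply: val_inj; rewrite /= ij.
by rewrite tnthS mxE; congr tnth; exact: val_inj.
Qed.

Lemma measurable_tuple_affine n m (M : 'M[R]_(n, m)) (b : 'rV_m) :
  measurable_fun setT (fun t : n.-tuple (measurableTypeR R) =>
    [tuple (row_of_tuple t *m M + b) 0 i | i < m] : m.-tuple (measurableTypeR R)).
Proof.
apply/measurable_fun_tnthP => i.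
rewrite (_ : _ \o _ = (fun t => \sum_(j < n) tnth t j * M j i + b 0 i)); last first.
  apply/funext => t /=; rewrite tnth_mktuple !mxE; congr (_ + _).
  by apply: eq_bigr => j _; rewrite mxE.
apply: measurable_funD => //; apply: measurable_sum => j.
by apply: measurable_funM => //; exact: measurable_tnth.
Qed.

Lemma rmeasurable_affine n m (A : set 'rV[R]_m) (M : 'M[R]_(n, m)) (b : 'rV_m) :
  rmeasurable A -> rmeasurable [set x | A (x *m M + b)].
Proof.
move=> mA; have := @measurable_tuple_affine _ _ M b measurableT _ mA.
rewrite setTI; congr measurable; apply/seteqP; split=> t /=;
  by rewrite (_ : row_of_tuple [tuple _ | i < m] = row_of_tuple t *m M + b)//;
    apply/rowP => i; rewrite mxE tnth_mktuple.
Qed.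

Lemma rmeasurable_dot_le n (u : 'rV[R]_n) (c : R) :
  rmeasurable [set x | dot x u <= c].
Proof.
have := @measurable_fun_ler _ _ _ setT
  (fun t : n.-tuple (measurableTypeR R) => dot (row_of_tuple t) u) (cst c).
move=> /(_ _ _ measurableT [set true]); rewrite setTI; apply => //.
apply: measurable_sum => j; apply: measurable_funM => //.
by rewrite (_ : (fun _ => _) = (fun t => tnth t j));
  [exact: measurable_tnth|apply/funext => t; rewrite mxE].
Qed.

Lemma rmeasurableI n (A B : set 'rV[R]_n) :
  rmeasurable A -> rmeasurable B -> rmeasurable (A `&` B).
Proof. by move=> mA mB; apply: measurableI. Qed.

Lemma rmeasurable_bigcap_nat n (A : nat -> set 'rV[R]_n) :
  (forall i, rmeasurable (A i)) -> rmeasurable (\bigcap_i A i).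
Proof.
by move=> mA; rewrite /rmeasurable preimage_bigcap; apply: bigcap_measurableType => k _; exact: mA.
Qed.

Lemma rmeasurable_bigcap_fin n (I : finType) (A : I -> set 'rV[R]_n) :
  (forall i, rmeasurable (A i)) -> rmeasurable (\bigcap_i A i).
Proof.
move=> mA; rewrite /rmeasurable preimage_bigcap.
by apply: fin_bigcap_measurable => [|i _]; [exact: finite_finset|exact: mA].
Qed.

Lemma le_volume n (A B : set 'rV[R]_n) : rmeasurable A -> rmeasurable B ->
  A `<=` B -> (volume A <= volume B)%E.
Proof.
by move=> mA mB AB; apply: le_measure; rewrite ?inE// => t; exact: AB.
Qed.

Lemma volume_ge0 n (A : set 'rV[R]_n) : (0 <= volume A)%E.
Proof. exact: measure_ge0. Qed.

Lemma rmeasurable_row_mxl n (A : set 'rV[R]_(1 + n)) (x : R) : rmeasurable A ->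
  rmeasurable [set y : 'rV_n | A (row_mx x%:M y)].
Proof.
move=> mA; have := @rmeasurable_affine n (1 + n) A (row_mx 0 1%:M) (row_mx x%:M 0) mA.
congr rmeasurable; apply/seteqP; split=> y /=;
  by rewrite mul_mx_row mulmx0 mulmx1 add_row_mx add0r addr0.
Qed.

(** Both orders of integration are needed, one for each triangular factor of a matrix: here the
    first coordinate is frozen, in [volume_fubini2] all the others are. *)
Lemma volume_fubini1 n (A : set 'rV[R]_(1 + n)) : rmeasurable A ->
  volume A = (\int[lebesgue_measure]_x volume [set y : 'rV_n | A (row_mx x%:M y)])%E.
Proof.
move=> mA; rewrite /volume /= /tuple_product /pushforward /product_measure1.
apply: eq_integral => x _ /=; congr (lebesgue_tuple _).
by apply/seteqP; split=> t; rewrite /xsection /= inE/= -row_of_tuple_cons.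
Qed.

Lemma volume_fubini2 n (A : set 'rV[R]_(1 + n)) : rmeasurable A ->
  volume A = (\int[lebesgue_tuple (n := n)]_t
    lebesgue_measure [set x : measurableTypeR R | A (row_mx x%:M (row_of_tuple t))])%E.
Proof.
move=> mA; rewrite /volume /= /tuple_product /pushforward.
have mA' : measurable (@tuple_cons R n @^-1` (@row_of_tuple n.+1 @^-1` A)).
  by rewrite -[X in measurable X]setTI; exact: measurable_tuple_cons.
transitivity ((lebesgue_measure \x^ @lebesgue_tuple R n)%E
    (@tuple_cons R n @^-1` (@row_of_tuple n.+1 @^-1` A))).
  by apply: product_measure_unique => // B C mB mC; exact: product_measure2E.
rewrite /product_measure2; apply: eq_integral => t _ /=.
congr (lebesgue_measure _); apply/seteqP; split=> x;
  by rewrite /ysection /= inE/= -row_of_tuple_cons.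
Qed.

End rows.

Section volume_affine.
Variable R : realType.

Definition affine_scaling n (M : 'M[R]_n) (b : 'rV_n) :=
  forall A : set 'rV[R]_n, rmeasurable A ->
  volume A = ((`|\det M|)%:E * volume [set x : 'rV_n | A (x *m M + b)%R])%E.

Lemma affine_scaling_comp n (M M' : 'M[R]_n) b b' :
  affine_scaling M b -> affine_scaling M' b' ->
  affine_scaling (M *m M') (b *m M' + b').
Proof.
move=> Mb Mb' A mA; rewrite (Mb' _ mA) (Mb _ (rmeasurable_affine _ _ mA)).
rewrite muleA -EFinM det_mulmx normrM mulrC; congr (_ * volume _)%E.
by apply/seteqP; split=> x /=; rewrite mulmxDl mulmxA addrA.
Qed.

(** With the last n coordinates y fixed, the first one undergoes x |-> a x + (y c + b), so the
    one-dimensional case applies inside the integral. *)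
Lemma affine_scaling_lower n (a : R) (c : 'cV_n) (b : R) : a != 0 ->
  affine_scaling (block_mx a%:M 0 c 1%:M) (row_mx b%:M 0 : 'rV_(1 + n)).
Proof.
move=> a0 A mA; rewrite (volume_fubini2 mA).
rewrite (volume_fubini2 (rmeasurable_affine _ _ mA)) det_lblock det1 mulr1 det_scalar1.
rewrite -ge0_integralZl//; last first.
  have mB := rmeasurable_affine (block_mx a%:M 0 c 1%:M) (row_mx b%:M 0) mA.
  have mB' : measurable (@tuple_cons R n @^-1` (@row_of_tuple R n.+1 @^-1`
      [set x : 'rV_(1 + n) | A (x *m block_mx a%:M 0 c 1%:M + row_mx b%:M 0)])).
    by rewrite -[X in measurable X]setTI; exact: measurable_tuple_cons.
  apply: eq_measurable_fun (measurable_fun_ysection lebesgue_measure mB') => t _ /=.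
  congr (lebesgue_measure _).
  by apply/seteqP; split=> x; rewrite /ysection /= inE/= row_of_tuple_cons.
apply: eq_integral => t _; set y := row_of_tuple t.
have mC : measurable [set x : measurableTypeR R | A (row_mx x%:M y)].
  have := @measurable_ysection _ _ _ _ _ t
    (_ : measurable (@tuple_cons R n @^-1` (@row_of_tuple R n.+1 @^-1` A))).
  rewrite (_ : ysection _ _ = [set x | A (row_mx x%:M y)]).
    apply; rewrite -[X in measurable X]setTI; exact: measurable_tuple_cons.
  by apply/seteqP; split=> x; rewrite /ysection /= inE/= row_of_tuple_cons.
rewrite (lebesgue_measure_affine ((y *m c) 0 0 + b) a0 mC).
congr (_ * lebesgue_measure _)%E; apply/funext => x /=.
rewrite mul_row_block mulmx0 mulmx1 add0r add_row_mx addr0 [y *m c]mx11_scalar.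
rewrite -scalar_mxM -!raddfD/=; congr (A (row_mx _%:M y)).
by rewrite [_%:M 0 0]mxE addrA [a * x]mulrC.
Qed.

(** With the first coordinate x fixed, the others undergo y |-> y M + (x r + b). This translation
    depends on x, whence the quantification over [b']. *)
Lemma affine_scaling_upper n (r : 'rV_n) (M : 'M[R]_n) (b : 'rV_n) :
  (forall b', affine_scaling M b') ->
  affine_scaling (block_mx 1%:M r 0 M) (row_mx 0 b : 'rV_(1 + n)).
Proof.
move=> scM A mA; rewrite (volume_fubini1 mA).
rewrite (volume_fubini1 (rmeasurable_affine _ _ mA)) det_ublock det1 mul1r.
rewrite -ge0_integralZl//; last first.
  have mB := rmeasurable_affine (block_mx 1%:M r 0 M) (row_mx 0 b) mA.
  have mB' : measurable (@tuple_cons R n @^-1` (@row_of_tuple R n.+1 @^-1`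
      [set x : 'rV_(1 + n) | A (x *m block_mx 1%:M r 0 M + row_mx 0 b)])).
    by rewrite -[X in measurable X]setTI; exact: measurable_tuple_cons.
  apply: eq_measurable_fun (measurable_fun_xsection (@lebesgue_tuple R n) mB') => t _ /=.
  congr ((@lebesgue_tuple R n) _).
  by apply/seteqP; split=> x; rewrite /xsection /= inE/= row_of_tuple_cons.
apply: eq_integral => x _; rewrite (scM (x *: r + b) _ (rmeasurable_row_mxl x mA)).
congr (_ * volume _)%E; apply/seteqP; split=> y /=;
  by rewrite mul_row_block mulmx0 mulmx1 addr0 add_row_mx addr0 mul_scalar_mx addrCA addrA.
Qed.

(** Induction on the dimension: a nonzero upper left entry yields a block LU factorization whose
    Schur complement [N] is again invertible. *)
Lemma affine_scaling_unitmx n (M : 'M[R]_n) b : M \in unitmx -> affine_scaling M b.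
Proof.
elim: n => [|n IHn] in M b *.
  move=> _ A mA; rewrite (_ : [set x | _] = A) ?det_mx00 ?normr1 ?mul1e//.
  by apply/funext => x /=; congr A; rewrite [LHS]thinmx0 [RHS]thinmx0.
have pivot (M' : 'M[R]_(1 + n)) b' : M' \in unitmx -> ulsubmx M' 0 0 != 0 ->
    affine_scaling M' b'.
  move=> uM a0; set a := ulsubmx M' 0 0 in a0.
  pose r := a^-1 *: ursubmx M'; pose c := dlsubmx M'.
  pose N := drsubmx M' - c *m r.
  have M'E : M' = block_mx a%:M 0 c 1%:M *m block_mx 1%:M r 0 N.
    rewrite -[LHS]submxK mulmx_block !mulmx0 !mul0mx !mulmx1 !mul1mx !addr0.
    rewrite mul_scalar_mx scalerA divff// scale1r /N addrC subrK.
    by congr block_mx; rewrite [LHS]mx11_scalar.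
  have uN : N \in unitmx.
    move: uM; rewrite M'E !unitmxE !det_mulmx det_lblock det_ublock !det1 mulr1 mul1r.
    by rewrite unitrM => /andP[].
  pose b0 := lsubmx b' 0 0; pose b1 := rsubmx b' - b0 *: r.
  have -> : b' = row_mx b0%:M 0 *m block_mx 1%:M r 0 N + row_mx 0 b1.
    rewrite mul_row_block !mulmx1 !mul0mx addr0 add_row_mx !addr0 mul_scalar_mx.
    by rewrite /b1 addrC subrK -[LHS]hsubmxK; congr row_mx; rewrite [LHS]mx11_scalar.
  rewrite M'E; apply: affine_scaling_comp; first exact: affine_scaling_lower.
  by apply: affine_scaling_upper => b''; exact: IHn.
change ('M[R]_(1 + n)) in M; change ('rV[R]_(1 + n)) in b => uM.
have [a0|] := eqVneq (ulsubmx M 0 0) 0; last exact: pivot.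
have [c0|/matrix0Pn[i [j]]] := eqVneq (dlsubmx M) 0.
  have := det_ublock (ulsubmx M) (ursubmx M) (drsubmx M); rewrite -c0 submxK => detM.
  by move: uM; rewrite unitmxE detM [ulsubmx M]mx11_scalar a0 det_scalar1 mul0r unitr0.
rewrite (ord1 j) => c0.
(* With a zero pivot, some entry below it is nonzero; the shear [E 1] adds that row to the first one
   and [E (-1)], itself of upper type, undoes this. *)
pose E (s : R) : 'M[R]_(1 + n) := block_mx 1%:M (s *: delta_mx 0 i) 0 1%:M.
have ME : M = E (-1) *m (E 1 *m M).
  rewrite mulmxA mulmx_block !mulmx0 !mul0mx !mulmx1 !mul1mx !addr0 add0r.
  by rewrite scaleN1r scale1r subrr -scalar_mx_block mul1mx.
have : affine_scaling (E (-1) *m (E 1 *m M)) (row_mx 0 0 *m (E 1 *m M) + b); last first.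
  by rewrite -ME row_mx0 mul0mx add0r.
apply: affine_scaling_comp.
  by apply: affine_scaling_upper => b'; apply: IHn; exact: unitmx1.
apply: pivot.
  rewrite unitmx_mul uM andbT unitmxE det_ublock !det1 mulr1; exact: unitr1.
rewrite -[M]submxK /E mulmx_block block_mxKul mul1mx scale1r -rowE mxE a0 add0r.
by rewrite mxE.
Qed.

End volume_affine.

(** * The volume of a simplex *)

Section simplex_volume.
Variable R : realType.
Local Notation mu := (@lebesgue_measure R).

Definition corner_simplex n (r : R) : set 'rV[R]_n :=
  [set x | (forall i, 0 <= x 0 i) /\ \sum_i x 0 i <= r].

Lemma rmeasurable_corner_simplex n r : rmeasurable (@corner_simplex n r).
Proof.
rewrite (_ : corner_simplex _ = \bigcap_(i : 'I_n) [set x | dot x (- delta_mx 0 i) <= 0]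
    `&` [set x | dot x (const_mx 1) <= r]).
  apply: rmeasurableI; last exact: rmeasurable_dot_le.
  by apply: rmeasurable_bigcap_fin => i; exact: rmeasurable_dot_le.
have dotE x (i : 'I_n) : dot x (- delta_mx 0 i) = - x 0 i.
  rewrite /dot (bigD1 i)//= big1 => [|k ki]; rewrite !mxE ?eqxx/=.
    by rewrite addr0 mulrN1.
  by rewrite (negPf ki) oppr0 mulr0.
have dot1 x : dot x (const_mx 1 : 'rV_n) = \sum_i x 0 i.
  by apply: eq_bigr => i _; rewrite mxE mulr1.
apply/seteqP; split=> x /= [x0 xr]; rewrite dot1 in xr *.
  by split=> // i _ /=; rewrite dotE oppr_le0.
by split=> // i; have := x0 i I; rewrite /= dotE oppr_le0.
Qed.

Lemma integral_corner_simplex n (r : R) : 0 <= r ->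
  (\int[mu]_(x in `[0%R, r]) (((r - x) ^+ n / n`!%:R)%R)%:E)%E = (r ^+ n.+1 / n.+1`!%:R)%:E.
Proof.
rewrite le_eqVlt => /predU1P[<-|r0].
  by rewrite set_itv1 integral_set1 expr0n mul0r.
have dG m (x : R) : is_derive x 1 (fun x : R => (r - x) ^+ m) (- (m%:R * (r - x) ^+ m.-1)).
  have -> : (fun x : R => (r - x) ^+ m) = (cst r - id) ^+ m.
    by apply/funext => y; rewrite exprfctE.
  by apply: is_derive_eq; rewrite /GRing.scale /= /cst !fctE; ring.
have cG m : continuous (fun x : R => (r - x) ^+ m / m`!%:R).
  move=> x; apply: cvgM; last exact: cvg_cst.
  suff : {for x, continuous (fun x : R => (r - x) ^+ m)} by [].
  by apply/differentiable_continuous/derivable1_diffP; case: (dG m x).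
pose F x : R := - ((r - x) ^+ n.+1 / n.+1`!%:R).
have cF : continuous F by move=> x; apply: cvgN; exact: cG.
have dF (x : R) : is_derive x 1 F ((r - x) ^+ n / n`!%:R).
  have n0 : n`!%:R != 0 :> R by rewrite pnatr_eq0 -lt0n fact_gt0.
  have -> : F = (- n.+1`!%:R^-1) \*: (fun x : R => (r - x) ^+ n.+1).
    by apply/funext => y; rewrite /F /= /GRing.scale /=; ring.
  have := dG n.+1 x => dGx; apply: is_derive_eq; rewrite /GRing.scale /=.
  by rewrite factS natrM; field; rewrite n0 nat1r pnatr_eq0.
have -> := @continuous_FTC2 _ (fun x => (r - x) ^+ n / n`!%:R) F 0 r r0.
- by rewrite -EFinB /F subrr expr0n subr0 mul0r oppr0 sub0r opprK.
- exact: continuous_subspaceT.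
- split.
  + by move=> x _; case: (dF x).
  + exact/cvg_at_right_filter/cF.
  + exact/cvg_at_left_filter/cF.
- by move=> x _; rewrite derive1E; case: (dF x).
Qed.

(** The slice at first coordinate x is the corner simplex of size r - x, and is empty unless 0 <= x
    <= r. *)
Lemma volume_corner_simplex n (r : R) : 0 <= r ->
  volume (@corner_simplex n r) = (r ^+ n / n`!%:R)%:E.
Proof.
elim: n r => [|n IHn] r r0.
  rewrite /volume /= expr0 fact0 divr1 diracE mem_set//=.
  by split=> [[]//|]; rewrite big_ord0.
rewrite (volume_fubini1 (rmeasurable_corner_simplex _)) -(integral_corner_simplex n r0).
rewrite [RHS]integral_mkcond; apply: eq_integral => x _; rewrite patchE.
have slice (y : 'rV_n) : corner_simplex (n:=1 + n) r (row_mx x%:M y) <->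
    0 <= x /\ @corner_simplex n (r - x) y.
  rewrite /corner_simplex /= big_split_ord big_ord1 /= row_mxEl mxE mulr1n.
  under eq_bigr do rewrite row_mxEr.
  rewrite lerBrDl; split=> [[x0 xr]|[x0 [y0 xr]]].
    split; first by have := x0 (lshift n ord0); rewrite row_mxEl mxE.
    by split=> // i; have := x0 (rshift 1 i); rewrite row_mxEr.
  split=> // i; case: (split_ordP i) => j ->.
    by rewrite row_mxEl ord1 mxE.
  by rewrite row_mxEr.
case: ifPn => [|xr].
  rewrite inE /= in_itv /= => /andP[x0 xr]; rewrite -IHn ?subr_ge0//.
  by congr volume; apply/seteqP; split=> y; [move/slice => -[]|move=> ?; apply/slice].
rewrite (_ : mkset _ = set0); first exact: (measure0 (@lebesgue_tuple R n)).
apply/seteqP; split=> // y /slice[x0 [y0 yr]]; move/negP: xr; apply.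
rewrite inE/= in_itv/= x0/=.
by rewrite -subr_ge0 (le_trans _ yr)// sumr_ge0.
Qed.

End simplex_volume.

(** * The volume of the ball *)

Section gaussian_integral.
Variable R : realType.
Local Notation mu := (@lebesgue_measure R).

Definition sqnorm n (t : n.-tuple (measurableTypeR R)) : R := \sum_(i < n) tnth t i ^+ 2.

Lemma measurable_sqnorm n : measurable_fun setT (@sqnorm n).
Proof.
apply: measurable_sum => i; apply: measurable_funX; exact: measurable_tnth.
Qed.

Lemma dot_row_of_tuple n (t : n.-tuple (measurableTypeR R)) :
  dot (row_of_tuple t) (row_of_tuple t) = sqnorm t.
Proof. by apply: eq_bigr => i _; rewrite mxE expr2. Qed.

Lemma sqnorm_cons n x (t : n.-tuple (measurableTypeR R)) :
  sqnorm (tuple_cons (x, t)) = x ^+ 2 + sqnorm t.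
Proof.
rewrite /sqnorm big_ord_recl; congr (_ + _).
by apply: eq_bigr => i _; rewrite tnthS; congr (tnth _ _ ^+ 2); exact: val_inj.
Qed.

(** The first evaluation of the Gaussian integral, as a product over the coordinates;
    [layer_cake_ball] is the second one. *)
Lemma integral_gauss_tuple n :
  (\int[@lebesgue_tuple R n]_t (expR (- sqnorm t))%:E = (Num.sqrt pi ^+ n)%:E)%E.
Proof.
have mG m : measurable_fun setT
    (fun t : m.-tuple (measurableTypeR R) => (expR (- sqnorm t))%:E).
  apply/measurable_EFinP; apply: measurableT_comp => //.
  by apply: measurable_funN; exact: measurable_sqnorm.
elim: n => [|n IHn].
  rewrite (_ : @lebesgue_tuple R 0 = \d_[tuple])// integral_dirac//.
    by rewrite diracT mul1e /sqnorm big_ord0 oppr0 expR0.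
  exact: mG.
transitivity (\int[(mu \x @lebesgue_tuple R n)%E]_p
    ((fun t => (expR (- sqnorm t))%:E) (tuple_cons p)))%E.
  rewrite [LHS](@ge0_integral_pushforward _ _ _ _ _ (@tuple_cons R n)
    (@measurable_tuple_cons R n) (mu \x @lebesgue_tuple R n)%E)//.
  exact: mG.
rewrite fubini_tonelli1; last 2 first.
- exact: measurableT_comp (mG _) (@measurable_tuple_cons R n).
- by move=> p; rewrite lee_fin expR_ge0.
rewrite /fubini_F.
under eq_integral => x _.
  under eq_integral => t _ do rewrite sqnorm_cons opprD expRD EFinM.
  rewrite ge0_integralZl//; last exact: mG.
  rewrite IHn; over.
rewrite ge0_integralZr//.
- by rewrite integralT_gauss exprS EFinM.
- by apply/measurable_EFinP; exact: measurable_gauss_fun.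
Qed.

(** The parameter is the squared radius: these are the sublevel sets of [sqnorm]. *)
Definition open_ball n (t : R) : set 'rV[R]_n := [set x | dot x x < t].

Lemma rmeasurable_open_ball n t : rmeasurable (@open_ball n t).
Proof.
have := @measurable_fun_ltr _ _ _ setT (@sqnorm n) (cst t).
move=> /(_ (@measurable_sqnorm n) _ measurableT [set true]); rewrite setTI.
move=> /(_ (measurable_cst _) I); congr measurable; apply/seteqP.
by split=> x; rewrite /= /open_ball /= dot_row_of_tuple.
Qed.

Lemma volume_open_ball n t : 0 < t ->
  volume (@open_ball n t) = ((Num.sqrt t ^+ n)%:E * volume (@open_ball n 1))%E.
Proof.
move=> t0; have st0 : 0 < Num.sqrt t by rewrite sqrtr_gt0.
have uM : (Num.sqrt t)%:M \in @unitmx R n.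
  by rewrite unitmxE det_scalar unitrX// unitfE gt_eqF.
rewrite (affine_scaling_unitmx 0 uM (rmeasurable_open_ball t)) det_scalar.
rewrite ger0_norm ?exprn_ge0 ?ltW//; congr (_ * volume _)%E.
apply/funext => x /=; rewrite /open_ball /= addr0 mul_mx_scalar.
have -> : dot (Num.sqrt t *: x) (Num.sqrt t *: x) = t * dot x x.
  rewrite /dot mulr_sumr; apply: eq_bigr => i _; rewrite !mxE.
  by rewrite mulrACA -expr2 sqr_sqrtr ?ltW.
by rewrite -[X in _ < X]mulr1 ltr_pM2l.
Qed.

Lemma integral_expRN_ray (q : R) :
  (\int[mu]_(t in `]q, +oo[) (expR (- t))%:E = (expR (- q))%:E)%E.
Proof.
rewrite integral_itv_obnd_cbnd; last first.
  apply/measurable_EFinP; apply: measurableT_comp => //; exact: measurable_funN.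
have cE : continuous (fun x : R => expR (- x)).
  by move=> x; apply: continuous_comp; [exact: opp_continuous|exact: continuous_expR].
have dE (x : R) : is_derive x 1 (fun x => - expR (- x)) (expR (- x)).
  have := is_derive1_comp (is_derive_expR (- x)) (is_deriveN (is_derive_id x 1)).
  by move=> /is_deriveN; rewrite mulrN1 opprK.
rewrite (@ge0_continuous_FTC2y _ (fun x => expR (- x)) (fun x => - expR (- x)) _ 0).
- by rewrite sub0e EFinN oppeK.
- by move=> x _; exact: expR_ge0.
- exact: continuous_subspaceT.
- by rewrite -oppr0; apply: cvgN; exact: cvgr_expR.
- by move=> x _; case: (dE x).
- by apply: cvg_at_right_filter; apply: cvgN; exact: cE.
- by move=> x _; rewrite derive1E; case: (dE x).
Qed.

(** Write exp(- |x|^2) as the integral of exp(- t) over t > |x|^2 and exchange: the level t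
    contributes a ball of volume t^(n/2) times that of the unit ball. The identity is kept in the
    extended reals since neither factor is known to be finite yet. *)
Lemma layer_cake_ball n :
  ((\int[mu]_(t in `]0%R, +oo[) (t `^ (n%:R / 2) * expR (- t))%:E) * 
    volume (@open_ball n 1) = (Num.sqrt pi ^+ n)%:E)%E.
Proof.
rewrite -integral_gauss_tuple.
pose f (p : measurableTypeR R * n.-tuple (measurableTypeR R)) : \bar R :=
  ((expR (- p.1) * (sqnorm p.2 < p.1)%R%:R)%:E).
have f0 p : (0 <= f p)%E by rewrite lee_fin mulr_ge0 ?expR_ge0.
have mf : measurable_fun setT f.
  apply/measurable_EFinP; apply: measurable_funM.
    by apply: measurableT_comp => //; apply: measurable_funN.
  apply: measurableT_comp => //.
  by apply: measurable_fun_ltr => //; exact: measurableT_comp (@measurable_sqnorm n) _.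
have := @fubini_tonelli _ _ _ _ R mu (@lebesgue_tuple R n) f mf f0.
rewrite /fubini_F /fubini_G /f /=.
under [in RHS]eq_integral => T _.
  rewrite (_ : (\int[_]_x _)%E = (expR (- sqnorm T))%:E); last first.
    rewrite -integral_expRN_ray [RHS]integral_mkcond; apply: eq_integral => t _.
    rewrite patchE mem_setE in_itv/= andbT.
    by case: ifP => _; rewrite ?mulr1 ?mulr0.
  over.
move=> /= <-; rewrite integral_mkcond -ge0_integralZr ?volume_ge0//; last 2 first.
- apply/(measurable_restrict _ _ _) => //; rewrite setTI; apply: measurable_funTS.
  apply/measurable_EFinP; apply: measurable_funM; first exact: measurable_powR.
  by apply: measurableT_comp => //; exact: measurable_funN.
- move=> t _; rewrite patchE; case: ifP => // _.
  by rewrite lee_fin mulr_ge0 ?powR_ge0 ?expR_ge0.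
apply: eq_integral => t _; rewrite patchE mem_setE in_itv/= andbT.
under [in RHS]eq_integral do rewrite EFinM.
rewrite ge0_integralZl; last 4 first.
- by [].
- apply/measurable_EFinP; apply: measurableT_comp => //.
  by apply: measurable_fun_ltr => //; exact: measurable_sqnorm.
- by move=> T _; rewrite lee_fin.
- by rewrite lee_fin expR_ge0.
have -> : (\int[@lebesgue_tuple R n]_T ((sqnorm T < t)%R%:R)%:E)%E = volume (@open_ball n t).
  transitivity (lebesgue_tuple ((@row_of_tuple R n @^-1` open_ball t) `&` setT)).
    rewrite -integral_indic//; last exact: rmeasurable_open_ball.
    apply: eq_integral => T _; rewrite indicE; congr (_%:R)%:E; congr nat_of_bool.
    rewrite -dot_row_of_tuple; apply/idP/idP; rewrite inE.
      by [].
    by [].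
  by rewrite setIT.
case: ifPn => [t0|].
  rewrite (volume_open_ball n t0) -powR12_sqrt ?ltW// -powR_mulrn ?powR_ge0// -powRrM.
  by rewrite [2^-1 * _]mulrC muleA -EFinM [expR _ * _]mulrC.
rewrite -leNgt => t0; have -> : volume (@open_ball n t) = 0%E; last first.
  by rewrite mule0 mul0e.
have v0 : volume (@set0 'rV[R]_n) = 0%E := measure0 (@lebesgue_tuple R n).
rewrite -v0; congr volume.
apply/seteqP; split=> // x; rewrite /open_ball /= => xt.
have : 0 <= dot x x by apply: sumr_ge0 => i _; rewrite -expr2 sqr_ge0.
by rewrite leNgt (lt_le_trans xt t0).
Qed.

Lemma rmeasurable_cube n (s : R) :
  rmeasurable [set x : 'rV[R]_n | forall i, - s < x 0 i < s].
Proof.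
rewrite (_ : mkset _ = \bigcap_(i : 'I_n) [set x : 'rV_n | - s < x 0 i < s]).
  apply: rmeasurable_bigcap_fin => i.
  have := @measurable_tnth _ (measurableTypeR R) n i measurableT _ (measurable_itv `]- s, s[).
  by rewrite setTI; congr measurable; apply/funext => t /=; rewrite in_itv/= mxE.
by apply/seteqP; split=> x /= h i; [move=> _; exact: h|exact: (h i I)].
Qed.

Lemma volume_cube n (s : R) : 0 <= s ->
  volume [set x : 'rV[R]_n | forall i, - s < x 0 i < s] = ((2 * s) ^+ n)%:E.
Proof.
move=> s0; have := @lebesgue_tuple_box R n (fun=> `]- s, s[%classic) (fun=> measurable_itv _).
rewrite lebesgue_measure_itv/= lte_fin.
rewrite (_ : (if _ then _ else _) = (2 * s)%:E); last first.
  rewrite -EFinB opprK -mulr2n mulr_natl; case: ltP => //.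
  by move=> ss; rewrite (_ : s = 0) ?mul0rn//; lra.
rewrite prodEFin prodr_const card_ord => <-.
by congr lebesgue_tuple; apply/seteqP; split=> t /= h i; have := h i;
  rewrite in_itv/= mxE.
Qed.

(** The cube of half-side n^(-1/2) lies in the ball. Besides positivity, this gives the upper bound
    on [Gamma] used in [helly_constant_le]. *)
Lemma volume_open_ball1_ge n : (0 < n)%N ->
  (((2 / Num.sqrt n%:R) ^+ n)%:E <= volume (@open_ball n 1))%E.
Proof.
move=> n0; have sn0 : 0 < Num.sqrt (n%:R : R) by rewrite sqrtr_gt0 ltr0n.
rewrite -volume_cube; last by rewrite invr_ge0 ltW.
apply: le_volume; last 1 first.
- move=> x h; rewrite /open_ball /=.
  apply: (@lt_le_trans _ _ (\sum_(i < n) n%:R^-1)); last first.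
    by rewrite sumr_const card_ord -[_ *+ _]mulr_natr mulVf// pnatr_eq0 -lt0n.
  apply: ltr_sum; last first.
    move=> i _; rewrite -expr2 -(@sqr_sqrtr _ n%:R) ?ler0n// -exprVn.
    have := h i; set c := (Num.sqrt _)^-1 => hi; nra.
  by apply/hasP; exists (Ordinal n0); rewrite ?mem_index_enum.
- exact: rmeasurable_cube.
- exact: rmeasurable_open_ball.
Qed.
End gaussian_integral.

(** * The constant of the theorem and its comparison with the unit ball *)

Section constants.
Variable R : realType.

(** In [layer_cake_ball] a product of two elements of [0, +oo] is a positive real, so both factors
    are positive and finite. Finiteness of the integral matters because [Gamma] is its real-valued
    version. *)
Lemma ball_Gamma n : (0 < n)%N -> exists b : R,
  [/\ 0 < b, volume (@open_ball R n 1) = b%:E, (2 / Num.sqrt n%:R) ^+ n <= b &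
    b * Gamma (n%:R / 2 + 1) = Num.sqrt pi ^+ n].
Proof.
move=> n0; have := layer_cake_ball R n; have := volume_open_ball1_ge R n0.
have c0 : 0 < (2 / Num.sqrt n%:R) ^+ n :> R.
  by rewrite exprn_gt0// divr_gt0// sqrtr_gt0 ltr0n.
rewrite /Gamma /Rintegral addrK.
set J := (\int[_]_(x in _) _)%E; have J0 : (0 <= J)%E.
  by apply: integral_ge0 => t _; rewrite lee_fin mulr_ge0 ?powR_ge0 ?expR_ge0.
have p0 : 0 < Num.sqrt pi ^+ n :> R by rewrite exprn_gt0// sqrtr_gt0 pi_gt0.
case: (volume _) => [b| |//].
  rewrite lee_fin => cb; have b0 := lt_le_trans c0 cb.
  move: J0; case: J => [J J0 [JE]| _|//]; first by exists b; split=> //; rewrite mulrC.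
  by rewrite gt0_mulye.
case: J J0 => [J| |//] _; rewrite ?mulyy// => _.
have [->|J0] := eqVneq J 0; first by rewrite mul0e => -[E]; move: p0; rewrite -E ltxx.
case: (ltgtP J 0) J0 => // J0 _; first by rewrite lt0_muley.
by rewrite gt0_muley.
Qed.

Definition helly_constant n : R :=
  n%:R `^ (n%:R / 2) * (n%:R + 1) `^ (3 * (n%:R + 1) / 2) /
    (pi `^ (n%:R / 2) * n`!%:R) * Gamma (n%:R / 2 + 1).

Lemma helly_constant_gt0 n : (0 < n)%N -> 0 < helly_constant n.
Proof.
move=> n0; have [b [b0 _ _ bG]] := ball_Gamma n0.
have G0 : 0 < Gamma (n%:R / 2 + 1) :> R.
  by rewrite -(pmulr_rgt0 _ b0) bG exprn_gt0// sqrtr_gt0 pi_gt0.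
rewrite /helly_constant natr1; apply: mulr_gt0 => //.
apply: divr_gt0; apply: mulr_gt0; rewrite ?powR_gt0 ?pi_gt0 ?ltr0n ?fact_gt0//.
Qed.

Lemma powR_half (a : R) k : 0 <= a -> a `^ (k%:R / 2) = Num.sqrt a ^+ k.
Proof.
by move=> a0; rewrite mulrC powRrM powR12_sqrt// powR_mulrn// sqrtr_ge0.
Qed.

Lemma helly_constantE n : helly_constant n =
  Num.sqrt n%:R ^+ n * Num.sqrt n.+1%:R ^+ (3 * n.+1) / (Num.sqrt pi ^+ n * n`!%:R) *
    Gamma (n%:R / 2 + 1).
Proof.
by rewrite /helly_constant natr1 -natrM !powR_half ?ler0n// pi_ge0.
Qed.

(** What the comparison in [helly_constant_ball] comes down to once the powers of n and n + 1 have
    cancelled. *)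
Lemma leq_2exp3_fact n : (0 < n)%N -> (2 * 3 ^ n <= n`! * n.+1 ^ 3)%N.
Proof.
case: n => // -[|[|n]] // _; elim: n => // n IHn.
rewrite expnS mulnCA factS -mulnA; apply: leq_mul => //.
by apply: (leq_trans IHn); rewrite leq_mul2l leq_exp2r// leqnSn orbT.
Qed.

Lemma bin_le_exp2 m k : ('C(m, k) <= 2 ^ m)%N.
Proof.
elim: m k => [|m IHm] [|k]; rewrite ?bin0 ?expn_gt0// binS expnS mul2n -addnn.
exact: leq_add.
Qed.

Lemma exp_le_ffact m k : (m ^ k <= (m + k) ^_ k)%N.
Proof.
elim: k => // k IHk; rewrite addnS ffactSS expnS leq_mul//.
by rewrite (leq_trans (leq_addr k m)).
Qed.

(** A substitute for Stirling: n^n <= (2n)! / n! = C(2n, n) n!. *)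
Lemma expnn_le_fact n : (n ^ n <= 4 ^ n * n`!)%N.
Proof.
apply: leq_trans (exp_le_ffact n n) _; rewrite -bin_ffact leq_mul2r.
by rewrite (leq_trans (bin_le_exp2 _ _)) ?orbT// expnD -expnMn.
Qed.

(** The origin of C = 8: with (n + 1)^3 <= 8^n and n + 1 <= 2n, the left side is at most (4 * 8 *
    8)^n n^(3n), and 256 <= 8^3. *)
Lemma helly_constant_bound_nat n : (0 < n)%N ->
  (4 ^ n * n.+1 ^ (3 * n.+1) <= (8 * n) ^ (3 * n))%N.
Proof.
move=> n0; rewrite mulnS expnD.
have h1 : (n.+1 ^ 3 <= 8 ^ n)%N.
  rewrite (_ : 8 = 2 ^ 3)%N// -expnM mulnC expnM leq_exp2r//; exact: ltn_expl.
have h2 : (n.+1 ^ (3 * n) <= (2 * n) ^ (3 * n))%N.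
  by rewrite leq_exp2r ?muln_gt0// mul2n -addnn -addn1 leq_add2l.
apply: (@leq_trans (4 ^ n * (8 ^ n * (2 * n) ^ (3 * n)))%N).
  by rewrite leq_mul2l leq_mul ?orbT.
rewrite !expnMn !mulnA leq_mul2r; apply/orP; right.
by rewrite !expnM -!expnMn leq_exp2r.
Qed.

(** The inscribed cube bounds [Gamma] by (pi n)^(n/2) / 2^n. With n^n <= 4^n n! the constant is then
    at most 2^n (n + 1)^(3(n+1)/2), and squaring leaves an inequality between integers. *)
Lemma helly_constant_le n : (0 < n)%N ->
  helly_constant n <= (8 * n%:R) `^ (3 * n%:R / 2).
Proof.
move=> n0; have [b [b0 _ cb bG]] := ball_Gamma n0.
rewrite -!natrM powR_half ?ler0n// helly_constantE.
set g := Gamma _ in bG *; set p := Num.sqrt pi in bG *.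
have p0 : 0 < p ^+ n by rewrite exprn_gt0// sqrtr_gt0 pi_gt0.
have sn : 0 < Num.sqrt (n%:R : R) by rewrite sqrtr_gt0 ltr0n.
have f0 : 0 < n`!%:R :> R by rewrite ltr0n fact_gt0.
set r := Num.sqrt n%:R in sn cb *; set q := Num.sqrt n.+1%:R ^+ _.
have q0 : 0 <= q by rewrite exprn_ge0// sqrtr_ge0.
have g0 : 0 < g by rewrite -(pmulr_rgt0 _ b0) bG.
have gle : g <= p ^+ n * r ^+ n / 2 ^+ n.
  rewrite ler_pdivlMr ?exprn_gt0// -bG.
  have := ler_wpM2l (ltW g0) cb; rewrite exprMn exprVn => h.
  have rn0 : 0 < r ^+ n by rewrite exprn_gt0.
  have := ler_wpM2r (ltW rn0) h; rewrite mulrA mulfVK ?gt_eqF//.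
  by rewrite [b * g]mulrC.
have e1 : r ^+ n * q / (p ^+ n * n`!%:R) * g <= 2 ^+ n * q.
  rewrite mulrAC ler_pdivrMr ?mulr_gt0//.
  have rn0 : 0 <= r ^+ n * q by rewrite mulr_ge0// exprn_ge0// ltW.
  apply: le_trans (ler_wpM2l rn0 gle) _.
  have nn : r ^+ n * r ^+ n <= 4 ^+ n * n`!%:R.
    rewrite -exprMn -expr2 sqr_sqrtr ?ler0n// -!natrX -natrM ler_nat.
    exact: expnn_le_fact.
  rewrite mulrA ler_pdivrMr ?exprn_gt0//.
  have := ler_wpM2r (mulr_ge0 q0 (ltW p0)) nn.
  have -> : 4 ^+ n = 2 ^+ n * 2 ^+ n :> R by rewrite -exprMn -natrM.
  by move=> h; apply: (le_trans _ (le_trans h _));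
    rewrite le_eqVlt; apply/orP; left; apply/eqP; ring.
apply: le_trans e1 _.
rewrite -(@ler_pXn2r _ 2)// ?nnegrE ?mulr_ge0 ?exprn_ge0 ?sqrtr_ge0//.
rewrite exprMn -!exprM ![(_ * 2)%N]mulnC !exprM !sqr_sqrtr ?ler0n//.
rewrite -!natrX -natrM ler_nat -[((n.+1 ^ 3) ^ _)%N]expnM -[(((8 * n) ^ 3) ^ _)%N]expnM.
exact: helly_constant_bound_nat.
Qed.

(** To be read with [b] the volume of the unit ball and [D], [s] the determinant and the norm of the
    sum of the selected normals; the left side is then [D] times the volume of the enclosing
    simplex. [Gamma] cancels against [b], and squaring removes the half-integer powers. *)
Lemma helly_constant_ball n (b s D : R) : (0 < n)%N ->
  b * Gamma (n%:R / 2 + 1) = Num.sqrt pi ^+ n ->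
  0 <= s -> s ^+ 2 <= 2 * n%:R -> 0 < D -> n`!%:R / (2 * n%:R ^+ n) <= D ^+ 2 ->
  (n%:R * (1 + s)) ^+ n / n`!%:R <= D * (helly_constant n * b).
Proof.
move=> n0 bG s0 sn D0 nD; rewrite helly_constantE.
set g := Gamma _ in bG *; set p := Num.sqrt pi in bG *.
have p0 : 0 < p ^+ n by rewrite exprn_gt0// sqrtr_gt0 pi_gt0.
have f0 : 0 < n`!%:R :> R by rewrite ltr0n fact_gt0.
set r := Num.sqrt n%:R; set q := Num.sqrt n.+1%:R ^+ _.
have -> : D * (r ^+ n * q / (p ^+ n * n`!%:R) * g * b) = D * (r ^+ n * q) / n`!%:R.
  rewrite -[_ * g * b]mulrA [g * b]mulrC bG; field; rewrite !gt_eqF//=.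
rewrite ler_pM2r ?invr_gt0//.
have nn0 : 0 < n%:R :> R by rewrite ltr0n.
rewrite -(@ler_pXn2r _ 2)// ?nnegrE; last 2 first.
- by rewrite exprn_ge0// mulr_ge0 ?addr_ge0// ltW.
- by rewrite !mulr_ge0 ?exprn_ge0 ?sqrtr_ge0// ltW.
have -> : (D * (r ^+ n * q)) ^+ 2 = D ^+ 2 * (n%:R ^+ n * n.+1%:R ^+ (3 * n.+1)).
  rewrite !exprMn /q /r -!exprM ![(_ * 2)%N]mulnC !exprM !sqr_sqrtr ?ler0n//.
have -> : ((n%:R * (1 + s)) ^+ n) ^+ 2 = (n%:R ^+ n) ^+ 2 * ((1 + s) ^+ 2) ^+ n.
  by rewrite !exprMn; congr (_ * _); rewrite exprAC.
(* (s - 2)^2 >= 0 gives (1 + s)^2 <= 3 + 3 s^2 / 2, and s^2 <= 2n. *)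
have s3 : (1 + s) ^+ 2 <= 3 * n.+1%:R by rewrite -natr1; have := sqr_ge0 (s - 2); rewrite !expr2 in sn *; nra.
have s3n : ((1 + s) ^+ 2) ^+ n <= (3 * n.+1%:R) ^+ n.
  by rewrite lerXn2r// nnegrE ?sqr_ge0// mulr_ge0.
have nN : (n%:R ^+ n) ^+ 2 <= (n.+1%:R ^+ n) ^+ 2 :> R.
  by rewrite lerXn2r ?nnegrE ?exprn_ge0// lerXn2r ?nnegrE// ler_nat.
have key : 2 * 3 ^+ n <= n`!%:R * n.+1%:R ^+ 3 :> R.
  by rewrite -!natrX -!natrM ler_nat leq_2exp3_fact.
have N0 : 0 <= n.+1%:R ^+ (3 * n) :> R by rewrite exprn_ge0.
apply: (@le_trans _ _ (n.+1%:R ^+ (3 * n) * 3 ^+ n)).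
  have h : n.+1%:R ^+ (3 * n) * 3 ^+ n = (n.+1%:R ^+ n) ^+ 2 * (3 * n.+1%:R) ^+ n :> R.
    rewrite exprMn mulrCA mulrC -exprM -exprD; congr (_ * _ ^+ _); lia.
  by rewrite h ler_pM//; exact/exprn_ge0/sqr_ge0.
apply: (@le_trans _ _
    (n`!%:R / (2 * n%:R ^+ n) * (n%:R ^+ n * n.+1%:R ^+ (3 * n.+1)))); last first.
  by rewrite ler_wpM2r// mulr_ge0 ?exprn_ge0.
have -> : n`!%:R / (2 * n%:R ^+ n) * (n%:R ^+ n * n.+1%:R ^+ (3 * n.+1)) =
    n.+1%:R ^+ (3 * n) * (n`!%:R * n.+1%:R ^+ 3 / 2) :> R.
  rewrite mulnS exprD; field; rewrite ?gt_eqF ?exprn_gt0//.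
by rewrite ler_wpM2l// ler_pdivlMr// mulrC.
Qed.

End constants.

(** * Selection of a large determinant *)

Section selection.
Variables (R : realType) (n : nat) (J : finType) (c : J -> R) (u : J -> 'rV[R]_n).
Hypothesis n_gt0 : (0 < n)%N.
Hypothesis c_ge0 : forall j, 0 <= c j.
Hypothesis c_sum : \sum_j c j = 1.
Hypothesis u_unit : forall j, c j != 0 -> dot (u j) (u j) = 1.
Hypothesis u_iso : forall p q, \sum_j c j * (u j 0 p * u j 0 q) = (p == q)%:R / n%:R.
Hypothesis u_center : forall p, \sum_j c j * u j 0 p = 0.

Implicit Types f : {ffun 'I_n -> J}.

Let w f := \prod_k c (f k).
Let U f := \matrix_(k, p) u (f k) 0 p.
Let det2 f := \det (U f) ^+ 2.
Let S f := \sum_k u (f k).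

(** Independence of the draws: the two Leibniz sums leave a product over k, whose mean is the
    product of the means. The factors [g] are 1 for the mean of D^2, and single out two draws in
    [cross]. *)
Let weighted_det2 (g : 'I_n -> J -> R) :
  \sum_f w f * (\prod_k g k (f k)) * det2 f =
  \sum_(s : 'S_n) \sum_(t : 'S_n) (-1) ^+ s * (-1) ^+ t *
    \prod_k \sum_j c j * g k j * (u j 0 (s k) * u j 0 (t k)).
Proof.
under [RHS]eq_bigr => s _ do under eq_bigr => t _ do rewrite bigA_distr_bigA mulr_sumr.
under [RHS]eq_bigr => s _ do rewrite exchange_big /=.
rewrite [RHS]exchange_big /=; apply: eq_bigr => f _.
rewrite /det2 expr2 /determinant big_distrlr /= mulr_sumr; apply: eq_bigr => s _.
rewrite mulr_sumr; apply: eq_bigr => t _.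
rewrite !big_split /= /w.
have UE (r : 'S_n) : \prod_i U f i (r i) = \prod_i u (f i) 0 (r i).
  by apply: eq_bigr => i _; rewrite mxE.
by rewrite !UE [X in _ * X = _]mulrACA [LHS]mulrCA.
Qed.

Let sum_w : \sum_f w f = 1.
Proof.
rewrite /w -(bigA_distr_bigA (fun=> c)) big1// => i _; exact: c_sum.
Qed.

Let iso1 (p q : 'I_n) : \sum_j c j * 1 * (u j 0 p * u j 0 q) = (p == q)%:R / n%:R.
Proof. by rewrite -u_iso; apply: eq_bigr => j _; rewrite mulr1. Qed.

(** By isotropy the k-th mean vanishes when s k differs from t k, so only the n! pairs with s = t
    remain, each contributing n^(-n). *)
Let mean_det2 : \sum_f w f * det2 f = n`!%:R / n%:R ^+ n.
Proof.
have := weighted_det2 (fun _ _ => 1).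
rewrite (eq_bigr (fun f => w f * det2 f)) => [->|f _]; last by rewrite big1_eq mulr1.
rewrite (eq_bigr (fun=> n%:R ^- n)) => [|s _].
  by rewrite sumr_const card_Sn -[_ *+ _]mulr_natr mulrC.
rewrite (bigD1 s)//= [X in _ + X]big1 ?addr0 => [|t ts].
  rewrite -signr_addb addbb mul1r.
  rewrite (eq_bigr (fun=> n%:R^-1)) ?prodr_const ?card_ord ?exprVn// => k _.
  by rewrite iso1 eqxx mul1r.
have [k kst] : exists k, s k != t k.
  apply/existsP; apply: contraNT ts; rewrite negb_exists => /forallP h.
  by apply/eqP/permP => k; apply/eqP; rewrite eq_sym; have := h k; rewrite negbK.
by rewrite (bigD1 k)//= iso1 (negPf kst) !mul0r mulr0.
Qed.

(** [T a] is the matrix of third moments with one index fixed to [a]; [Q a p q] is its principal 2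
    by 2 minor. *)
Let T a p q := \sum_j c j * u j 0 a * (u j 0 p * u j 0 q).
Let Q a p q := T a p p * T a q q - T a p q * T a q p.

(* In the Leibniz expansion of [det2] only the pairs (s, s) and (s, (k l) s)
   contribute, as all columns but [k] and [l] are averaged isotropically. *)
Let cross (a k l : 'I_n) : k != l ->
  \sum_f w f * det2 f * (u (f k) 0 a * u (f l) 0 a) =
  n%:R ^- (n - 2) * \sum_(s : 'S_n) Q a (s k) (s l).
Proof.
move=> kl; pose g m j := if m \in pred2 k l then u j 0 a else 1.
have prodg (F : 'I_n -> R) (x : 'I_n -> R) :
    \prod_m (if m \in pred2 k l then F m else x m) =
    F k * F l * \prod_(m | m \notin pred2 k l) x m.
  have lk : l != k by rewrite eq_sym.
  rewrite (bigD1 k)//= (bigD1 l)//= !inE !eqxx orbT mulrA; congr (_ * _).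
  apply: eq_big => m; first by rewrite !inE negb_or.
  by rewrite !inE => /andP[/negPf-> /negPf->].
rewrite (eq_bigr (fun f => w f * (\prod_m g m (f m)) * det2 f)) => [|f _]; last first.
  by rewrite /g prodg big1// mulr1; ring.
rewrite weighted_det2 mulr_sumr; apply: eq_bigr => s _.
have gM m p q : \sum_j c j * g m j * (u j 0 p * u j 0 q) =
    if m \in pred2 k l then T a p q else (p == q)%:R / n%:R.
  by rewrite /g; case: ifP => _; rewrite ?iso1.
have tk : (tperm k l * s)%g k = s l by rewrite permM tpermL.
have tl : (tperm k l * s)%g l = s k by rewrite permM tpermR.
have s_neq : (tperm k l * s)%g != s.
  by apply/eqP => /permP/(_ k); rewrite tk => /perm_inj/eqP; rewrite eq_sym (negPf kl).
rewrite (bigD1 s)//= (bigD1 (tperm k l * s)%g)//= [X in _ + (_ + X)]big1 ?addr0; last first.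
  move=> t /andP[ts tkls].
  (* A permutation that agrees with s off k and l is s or its composite with the transposition, both
     excluded here; a disagreement at such an m kills the product. *)
  have [m mkl stm] : exists2 m, m \notin pred2 k l & s m != t m.
    apply/exists_inP; apply: contraT; rewrite negb_exists_in => /forall_inP h.
    have {}h m : m != k -> m != l -> t m = s m.
      move=> mk ml; apply/esym/eqP; rewrite -[_ == _]negbK; apply: h.
      by rewrite !inE negb_or mk.
    have himg x y : x != y -> x \in pred2 k l -> y \in pred2 k l -> t x = s x \/ t x = s y.
      move=> xy xkl ykl; pose m := (s^-1)%g (t x).
      have sm : s m = t x by rewrite permKV.
      have [mx|mx] := eqVneq m x; first by left; rewrite -sm mx.
      have [my|my] := eqVneq m y; first by right; rewrite -sm my.
      have : m \notin pred2 k l.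
        by move: xkl ykl xy mx my; rewrite !inE => /orP[]/eqP-> /orP[]/eqP->;
          rewrite ?eqxx// => _ /negPf-> /negPf->.
      rewrite !inE negb_or => /andP[mk ml].
      by have := h m mk ml; rewrite sm => /perm_inj mx'; rewrite mx' eqxx in mx.
    have kin : k \in pred2 k l by rewrite !inE eqxx.
    have lin : l \in pred2 k l by rewrite !inE eqxx orbT.
    have lk : l != k by rewrite eq_sym.
    have [tsk|tsk] := himg k l kl kin lin; have [tsl|tsl] := himg l k lk lin kin.
    - case/eqP: ts; apply/permP => m.
      by have [->//|mk] := eqVneq m k; have [->//|ml] := eqVneq m l; exact: h.
    - by move: kl; rewrite -(inj_eq (@perm_inj _ t)) tsk tsl eqxx.
    - by move: kl; rewrite -(inj_eq (@perm_inj _ t)) tsk tsl eqxx.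
    - case/eqP: tkls; apply/permP => m.
      have [->|mk] := eqVneq m k; first by rewrite tk.
      have [->|ml] := eqVneq m l; first by rewrite tl.
      by rewrite permM tpermD 1?eq_sym// h.
  by rewrite (bigD1 m)//= gM (negPf mkl) (negPf stm) !mul0r mulr0.
under eq_bigr do rewrite gM.
under [X in _ + _ * X]eq_bigr do rewrite gM.
rewrite !prodg tk tl odd_permM odd_tperm kl /= -!signr_addb addbb.
have -> : s (+) ~~ s = true by case: (s : bool).
rewrite expr0 expr1 mul1r mulN1r.
have cardD : #|[pred m | m \notin pred2 k l]| = (n - 2)%N.
  have := cardC (pred2 k l); rewrite card2 kl => e.
  transitivity (#|'I_n| - 2)%N; last by rewrite card_ord.
  by rewrite -e addnC addnK.
have diagE (t : 'S_n) : (forall m, m \notin pred2 k l -> t m = s m) ->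
    \prod_(m | m \notin pred2 k l) ((s m == t m)%:R / n%:R) = n%:R ^- (n - 2) :> R.
  move=> ts; rewrite (eq_bigr (fun=> n%:R^-1)) => [|m /ts ->]; last by rewrite eqxx mul1r.
  by rewrite prodr_const cardD exprVn.
rewrite !diagE// => [|m]; last first.
  by rewrite !inE negb_or => /andP[mk ml]; rewrite permM tpermD 1?eq_sym.
rewrite /Q; ring.
Qed.

(* By [cross] the off-diagonal terms add up to a multiple of the sum over [a] of
   tr(T a)^2 - tr((T a)^2), where tr(T a) = 0 because the [u j] are centered. *)
Let mean_det2_sq_norm : \sum_f w f * det2 f * dot (S f) (S f) <= n%:R * \sum_f w f * det2 f.
Proof.
have E f : w f * det2 f * dot (S f) (S f) = n%:R * (w f * det2 f) +
    \sum_a \sum_k \sum_(l | l != k) w f * det2 f * (u (f k) 0 a * u (f l) 0 a).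
  (* Only indices of nonzero weight are known to carry unit vectors, so draws of weight zero are set
     apart. *)
  have [w0|w0] := eqVneq (w f) 0.
    rewrite w0 !mul0r mulr0 add0r big1// => a _; rewrite big1// => k _.
    by rewrite big1// => l _; rewrite !mul0r.
  have uf k : dot (u (f k)) (u (f k)) = 1.
    by apply: u_unit; move: w0; apply: contraNneq => ck; rewrite /w (bigD1 k)//= ck mul0r.
  have -> : dot (S f) (S f) = n%:R +
      \sum_a \sum_k \sum_(l | l != k) u (f k) 0 a * u (f l) 0 a.
    have -> : n%:R = \sum_a \sum_k u (f k) 0 a * u (f k) 0 a.
      rewrite exchange_big /= (eq_bigr (fun=> 1)) => [|k _]; last exact: uf.
      by rewrite sumr_const card_ord.
    rewrite -big_split; apply: eq_bigr => a _; rewrite -big_split /=.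
    rewrite /S summxE mulr_suml; apply: eq_bigr => k _.
    by rewrite mulr_sumr (bigD1 k).
  rewrite mulrDr mulrC; congr (_ + _); rewrite mulr_sumr; apply: eq_bigr => a _.
  by rewrite mulr_sumr; apply: eq_bigr => k _; rewrite mulr_sumr.
rewrite (eq_bigr _ (fun f _ => E f)) big_split -mulr_sumr /= gerDl exchange_big /=.
apply: sumr_le0 => a _; rewrite exchange_big /=.
under eq_bigr => k _.
  rewrite exchange_big /=.
  under eq_bigr => l lk do rewrite cross 1?eq_sym//.
  rewrite -mulr_sumr exchange_big /=.
  over.
rewrite -mulr_sumr mulr_ge0_le0 ?invr_ge0 ?exprn_ge0// exchange_big.
apply: sumr_le0 => s _ /=.
(* The minor [Q a p p] is zero, so the missing diagonal term can be added. *)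
have QE k : \sum_(l | l != k) Q a (s k) (s l) = \sum_q Q a (s k) q.
  rewrite [RHS](reindex_inj (@perm_inj _ s)) [RHS](bigD1 k)//= /Q subrr add0r.
  by [].
under eq_bigr do rewrite QE.
have -> : \sum_k \sum_q Q a (s k) q = \sum_p \sum_q Q a p q.
  by rewrite [RHS](reindex_inj (@perm_inj _ s)).
have trT : \sum_p T a p p = 0.
  rewrite exchange_big /= -[RHS](u_center a); apply: eq_bigr => j _.
  rewrite -mulr_sumr; have [->|cj] := eqVneq (c j) 0; first by rewrite !mul0r.
  by rewrite (_ : \sum_i _ = dot (u j) (u j))// u_unit// mulr1.
rewrite /Q; under eq_bigr do rewrite sumrB -mulr_sumr trT mulr0 sub0r.
rewrite sumrN oppr_le0; apply: sumr_ge0 => p _; apply: sumr_ge0 => q _.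
rewrite (_ : T a q p = T a p q) -?expr2 ?sqr_ge0//.
by apply: eq_bigr => j _; rewrite [u j 0 q * _]mulrC.
Qed.

(** If every draw failed one of the two bounds, then D^2 < A/2 + D^2 s^2 / (2n) for all of them, [A]
    being the mean of D^2. Averaging gives A < A/2 + A/2, because D^2 s^2 has mean at most n A. *)
Lemma exists_selection : exists f : 'I_n -> J,
  n`!%:R / (2 * n%:R ^+ n) <= \det (\matrix_(k, p) u (f k) 0 p) ^+ 2 /\
  dot (\sum_k u (f k)) (\sum_k u (f k)) <= 2 * n%:R.
Proof.
set A := n`!%:R / n%:R ^+ n : R; have mean : \sum_f w f * det2 f = A := mean_det2.
have nn0 : 0 < n%:R :> R by rewrite ltr0n.
have A0 : 0 < A by rewrite divr_gt0 ?exprn_gt0// ltr0n fact_gt0.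
have w0 f : 0 <= w f by apply: prodr_ge0.
have AE : n`!%:R / (2 * n%:R ^+ n) = A / 2 by rewrite /A; field; rewrite gt_eqF// exprn_gt0.
apply: contrapT => H.
have bad f : det2 f < A / 2 + det2 f * dot (S f) (S f) / (2 * n%:R).
  have d0 : 0 <= det2 f by exact: sqr_ge0.
  have s0 : 0 <= dot (S f) (S f) by apply: sumr_ge0 => i _; rewrite -expr2 sqr_ge0.
  rewrite -mulrA; have [dA|Ad] := ltP (det2 f) (A / 2).
    by apply: lt_le_trans dA _; rewrite lerDl; apply: mulr_ge0 => //; apply: divr_ge0.
  have [sn|ns] := leP (dot (S f) (S f)) (2 * n%:R).
    by exfalso; apply: H; exists f; rewrite AE.
  apply: (@le_lt_trans _ _ (det2 f * (dot (S f) (S f) / (2 * n%:R)))).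
    by rewrite ler_peMr// ler_pdivlMr ?mul1r ?mulr_gt0// ltW.
  by rewrite ltrDr divr_gt0.
have : 0 < \sum_f w f * (A / 2 + det2 f * dot (S f) (S f) / (2 * n%:R) - det2 f).
  have d0 f : 0 < A / 2 + det2 f * dot (S f) (S f) / (2 * n%:R) - det2 f.
    by rewrite subr_gt0.
  rewrite lt_def sumr_ge0 ?andbT => [|f _]; last by rewrite mulr_ge0// ltW.
  rewrite psumr_eq0 => [|f _]; last by rewrite mulr_ge0// ltW.
  apply/negP => /allP h; have := sum_w; rewrite big1 => [/eqP|f _].
    by rewrite eq_sym oner_eq0.
  have /implyP/(_ isT) := h f (mem_index_enum _).
  by rewrite mulf_eq0 (gt_eqF (d0 f)) orbF => /eqP.
rewrite (eq_bigr (fun f => A / 2 * w f + (2 * n%:R)^-1 * (w f * det2 f * dot (S f) (S f))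
    - w f * det2 f)); last by move=> f _; ring.
rewrite sumrB big_split -!mulr_sumr /= sum_w mean mulr1.
have := mean_det2_sq_norm; rewrite mean => B.
rewrite ltNge subr_le0; move/negP; apply.
rewrite -[leRHS](@subrK _ (A / 2)) addrC lerD2r.
rewrite mulrC ler_pdivrMr ?mulr_gt0//; apply: le_trans B _.
by rewrite le_eqVlt; apply/orP; left; apply/eqP; field.
Qed.

End selection.

(** * Finite-dimensional convexity *)

Section continuity.
Variables (R : realType) (T : topologicalType).
Implicit Types f g : T -> R.

Lemma continuous_fun_add f g : continuous f -> continuous g ->
  continuous (fun x => f x + g x).
Proof. by move=> cf cg x; apply: cvgD; [exact: cf|exact: cg]. Qed.

Lemma continuous_fun_mul f g : continuous f -> continuous g ->
  continuous (fun x => f x * g x).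
Proof. by move=> cf cg x; apply: cvgM; [exact: cf|exact: cg]. Qed.

Lemma continuous_fun_opp f : continuous f -> continuous (fun x => - f x).
Proof. by move=> cf x; apply: cvgN; exact: cf. Qed.

Lemma continuous_fun_sum (I : Type) (r : seq I) (P : pred I) (F : I -> T -> R) :
  (forall i, continuous (F i)) -> continuous (fun x => \sum_(i <- r | P i) F i x).
Proof.
move=> cF; elim: r => [|i r IHr].
  rewrite (_ : (fun _ => _) = cst 0); first exact: cst_continuous.
  by apply/funext => x; rewrite big_nil.
rewrite (_ : (fun _ => _) = if P i then fun x => F i x + \sum_(j <- r | P j) F j x
    else fun x => \sum_(j <- r | P j) F j x).
  by case: (P i) => //; exact: continuous_fun_add.
by apply/funext => x; rewrite big_cons; case: (P i).
Qed.

Lemma continuous_fun_prod (I : Type) (r : seq I) (P : pred I) (F : I -> T -> R) :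
  (forall i, continuous (F i)) -> continuous (fun x => \prod_(i <- r | P i) F i x).
Proof.
move=> cF; elim: r => [|i r IHr].
  rewrite (_ : (fun _ => _) = cst 1); first exact: cst_continuous.
  by apply/funext => x; rewrite big_nil.
rewrite (_ : (fun _ => _) = if P i then fun x => F i x * \prod_(j <- r | P j) F j x
    else fun x => \prod_(j <- r | P j) F j x).
  by case: (P i) => //; exact: continuous_fun_mul.
by apply/funext => x; rewrite big_cons; case: (P i).
Qed.

Lemma closed_fun_le f g : continuous f -> continuous g ->
  closed [set x | f x <= g x].
Proof.
move=> cf cg; rewrite (_ : mkset _ = (fun x => g x + - f x) @^-1` [set y | 0 <= y]).
  apply: (continuous_closedP _).1; last exact: closed_ge.
  exact: continuous_fun_add (continuous_fun_opp cf).
by apply/seteqP; split=> x /=; rewrite subr_ge0.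
Qed.

End continuity.

Section finite_dimension.
Variable R : realType.

Lemma bounded_EVT_max d (C : set 'rV[R]_d) (b : R) (f : 'rV[R]_d -> R) :
  C !=set0 -> closed C -> (forall x, C x -> forall i, - b <= x 0 i <= b) ->
  continuous f -> exists2 x, C x & forall y, C y -> f y <= f x.
Proof.
move=> C0 clC Cb cf.
have cC : compact C.
  apply: subclosed_compact clC (@rV_compact _ d (fun=> `[- b, b]%classic) _) _.
    by move=> _; exact: segment_compact.
  by move=> x Cx i /=; rewrite in_itv/=; exact: Cb.
have [x xC fx] := EVT_max_rV C0 cC (continuous_subspaceT cf).
by exists x; [rewrite inE in xC|move=> y Cy; apply: fx; rewrite inE].
Qed.

Lemma dotDl d (x y z : 'rV[R]_d) : dot (x + y) z = dot x z + dot y z.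
Proof. by rewrite /dot -big_split; apply: eq_bigr => i _; rewrite mxE mulrDl. Qed.

Lemma dotC d (x y : 'rV[R]_d) : dot x y = dot y x.
Proof. by apply: eq_bigr => i _; rewrite mulrC. Qed.

Lemma dotDr d (x y z : 'rV[R]_d) : dot x (y + z) = dot x y + dot x z.
Proof. by rewrite dotC dotDl !(dotC x). Qed.

Lemma dotZl d a (x y : 'rV[R]_d) : dot (a *: x) y = a * dot x y.
Proof. by rewrite /dot mulr_sumr; apply: eq_bigr => i _; rewrite mxE mulrA. Qed.

Lemma dotZr d a (x y : 'rV[R]_d) : dot x (a *: y) = a * dot x y.
Proof. by rewrite dotC dotZl dotC. Qed.

Lemma dotNl d (x y : 'rV[R]_d) : dot (- x) y = - dot x y.
Proof. by rewrite -scaleN1r dotZl mulN1r. Qed.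

Lemma dotNr d (x y : 'rV[R]_d) : dot x (- y) = - dot x y.
Proof. by rewrite dotC dotNl dotC. Qed.

Lemma dot0l d (x : 'rV[R]_d) : dot 0 x = 0.
Proof. by apply: big1 => i _; rewrite mxE mul0r. Qed.

Lemma dot_suml d (I : finType) (F : I -> 'rV[R]_d) y :
  dot (\sum_i F i) y = \sum_i dot (F i) y.
Proof.
by elim/big_rec2: _ => [|i a b _ <-]; [exact: dot0l|rewrite dotDl].
Qed.

Lemma dot_sumr d (I : finType) (F : I -> 'rV[R]_d) y :
  dot y (\sum_i F i) = \sum_i dot y (F i).
Proof. by rewrite dotC dot_suml; apply: eq_bigr => i _; rewrite dotC. Qed.

Lemma dot_mulmx d (x y : 'rV[R]_d) (A : 'M[R]_d) : dot (x *m A) y = dot x (y *m A^T).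
Proof.
rewrite /dot; under eq_bigr do rewrite mxE mulr_suml.
under [RHS]eq_bigr do rewrite mxE mulr_sumr.
rewrite exchange_big; apply: eq_bigr => k _; apply: eq_bigr => l _.
by rewrite [A^T _ _]mxE; ring.
Qed.

Lemma dot_ge0 d (x : 'rV[R]_d) : 0 <= dot x x.
Proof. by apply: sumr_ge0 => i _; rewrite -expr2 sqr_ge0. Qed.

Lemma dot_eq0 d (x : 'rV[R]_d) : (dot x x == 0) = (x == 0).
Proof.
apply/idP/eqP => [|->]; last by rewrite dot0l.
rewrite psumr_eq0 => [/allP h|i _]; last by rewrite -expr2 sqr_ge0.
apply/rowP => i; rewrite mxE; have := h i (mem_index_enum _).
by rewrite /= -expr2 sqrf_eq0 => /eqP.
Qed.

Lemma dot_gt0 d (x : 'rV[R]_d) : x != 0 -> 0 < dot x x.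
Proof. by move=> x0; rewrite lt_def dot_eq0 x0 dot_ge0. Qed.

Lemma dot_cauchy d (x y : 'rV[R]_d) : dot x y ^+ 2 <= dot x x * dot y y.
Proof.
have [->|y0] := eqVneq y 0; first by rewrite !(dotC _ 0) !dot0l expr0n mulr0.
have := dot_ge0 (dot y y *: x - dot x y *: y).
rewrite !(dotDl, dotDr, dotNl, dotNr, dotZl, dotZr) (dotC y x) => h.
have yy := dot_gt0 y0.
rewrite -subr_ge0 -(pmulr_rge0 _ yy); apply: le_trans h _.
by rewrite le_eqVlt; apply/orP; left; apply/eqP; ring.
Qed.

(* The separating vector is the point of the convex hull that is closest to the
   origin. *)
Lemma gordan m d (p : 'I_m -> 'rV[R]_d) :
  (exists c : 'I_m -> R, [/\ forall i, 0 <= c i, \sum_i c i = 1 & \sum_i c i *: p i = 0])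
  \/ (exists y, forall i, 0 < dot y (p i)).
Proof.
case: m p => [|m] p; first by right; exists 0; case.
pose C := [set c : 'rV[R]_m.+1 | (forall i, 0 <= c 0 i) /\ \sum_i c 0 i = 1].
pose P (c : 'rV[R]_m.+1) := \sum_i c 0 i *: p i.
have C0 : C !=set0.
  exists (delta_mx 0 ord0); split=> [i|]; first by rewrite mxE ler0n.
  rewrite (bigD1 ord0)//= big1 ?mxE ?eqxx ?addr0// => i i0.
  by rewrite mxE (negPf i0) andbF.
have cc i : continuous (fun c : 'rV[R]_m.+1 => c 0 i) by exact: coord_continuous.
have csum : continuous (fun c : 'rV[R]_m.+1 => \sum_i c 0 i).
  exact: continuous_fun_sum.
have clC : closed C.
  rewrite (_ : C = (\bigcap_i [set c : 'rV[R]_m.+1 | 0 <= c 0 i]) `&`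
    ([set c : 'rV[R]_m.+1 | \sum_i c 0 i <= 1] `&`
     [set c : 'rV[R]_m.+1 | 1 <= \sum_i c 0 i])).
    apply: closedI; [apply: closed_bigI => i _|apply: closedI];
      by apply: closed_fun_le => //; exact: cst_continuous.
  apply/seteqP; split=> c /= [c0 c1].
    by split; [move=> i _; exact: c0|rewrite c1].
  by split; [move=> i; exact: c0|apply/eqP; rewrite eq_le; apply/andP].
have Cb c : C c -> forall i, - 1 <= c 0 i <= 1.
  move=> [c0 c1] i; rewrite (le_trans _ (c0 i)) ?lerN10//= -c1 (bigD1 i)//=.
  by rewrite lerDl sumr_ge0.
have cP : continuous (fun c => - dot (P c) (P c)).
  have cPi i : continuous (fun c => P c 0 i).
    have -> : (fun c => P c 0 i) = (fun c => \sum_j c 0 j * p j 0 i).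
      by apply/funext => c; rewrite summxE; apply: eq_bigr => j _; rewrite mxE.
    apply: continuous_fun_sum => j; apply: continuous_fun_mul => //.
    exact: cst_continuous.
  apply: continuous_fun_opp; apply: continuous_fun_sum => i.
  exact: continuous_fun_mul.
have [c [c0 c1] cmax] := bounded_EVT_max C0 clC Cb cP.
have [Pc|Pc] := eqVneq (P c) 0; first by left; exists (fun i => c 0 i).
right; exists (P c) => i.
have {}Pc := dot_gt0 Pc.
rewrite ltNge; apply/negP => yi.
pose a := dot (P c) (P c); pose q := dot (P c) (p i); pose b := dot (p i) (p i).
have b0 : 0 <= b by exact: dot_ge0.
have ab : 0 < a + b by rewrite ltr_wpDr.
(* Moving from [P c] towards [p i] by t changes the squared norm by t (t (a + b) - 2 a + 2 (1 - t)
   q). For this t and q <= 0 that is at most - t a < 0, contradicting the choice of [c]. *)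
have [t [t0 t1 tE]] : exists t, [/\ 0 < t, t <= 1 & t * (a + b) = a].
  exists (a / (a + b)); split; first by rewrite divr_gt0.
    by rewrite ler_pdivrMr// mul1r lerDl.
  by rewrite divfK// gt_eqF.
pose e := (1 - t) *: c + t *: delta_mx 0 i.
have Ce : C e.
  split=> [j|].
    by rewrite !mxE addr_ge0// mulr_ge0 ?ler0n ?subr_ge0// ltW.
  under eq_bigr do rewrite !mxE eqxx /=; rewrite big_split -!mulr_sumr /= c1.
  by rewrite (bigD1 i)//= eqxx big1 => [|j /negPf->//]; rewrite addr0 !mulr1 subrK.
have Pe : P e = (1 - t) *: P c + t *: p i.
  rewrite /P; under eq_bigr do rewrite !mxE eqxx /= scalerDl -!scalerA.
  rewrite big_split -!scaler_sumr /=; congr (_ + _ *: _).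
  by rewrite (bigD1 i)//= eqxx scale1r big1 ?addr0// => j /negPf->; rewrite scale0r.
have := cmax e Ce; rewrite lerN2 Pe !(dotDl, dotDr, dotZl, dotZr) (dotC (p i)).
rewrite -/a -/b -/q leNgt => /negP; apply.
have -> : (1 - t) * ((1 - t) * a) + (1 - t) * (t * q) + (t * ((1 - t) * q) + t * (t * b))
  = a + t * (t * (a + b) - 2 * a + 2 * (1 - t) * q) by ring.
rewrite gtrDl pmulr_rlt0// tE.
have : (1 - t) * q <= 0 by rewrite mulr_ge0_le0// subr_ge0.
have a0 : 0 < a := Pc.
rewrite -mulrA; move: (_ * q) => X; lra.
Qed.

(** The conical version: more than d charged points satisfy a linear relation [z] with a positive
    entry. Subtracting the largest multiple of [z] that keeps the weights nonnegative cancels one of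
    them. *)
Lemma caratheodory (J : finType) d (p : J -> 'rV[R]_d) (w : J -> R) :
  (forall j, 0 <= w j) -> exists w' : J -> R,
  [/\ forall j, 0 <= w' j, \sum_j w' j *: p j = \sum_j w j *: p j
    & (#|[pred j | (w' j != 0)%R]| <= d)%N].
Proof.
move: {2}(#|_|) (leqnn #|[pred j | w j != 0]|) => k.
elim: k w => [|k IHk] w wk w0.
  by exists w; split=> //; exact: leq_trans wk _.
have [wd|dw] := leqP #|[pred j | w j != 0]| d; first by exists w.
set s := [pred j | w j != 0] in wk dw.
pose M := \matrix_(i < #|s|) p (enum_val i).
have /matrix0Pn[r [j0 zr]] : kermx M != 0.
  rewrite -mxrank_eq0 mxrank_ker subn_eq0 -ltnNge.
  exact: leq_ltn_trans (rank_leq_col M) dw.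
have [z [zp zs [x0 z0]]] : exists z : J -> R, [/\ \sum_x z x *: p x = 0,
    forall x, w x = 0 -> z x = 0 & exists x, 0 < z x].
  pose z x := \sum_(i | enum_val i == x) kermx M r i.
  have zp : \sum_x z x *: p x = 0.
    have /rowP kM : row r (kermx M) *m M = 0 by rewrite -row_mul mulmx_ker row0.
    transitivity (\sum_i kermx M r i *: p (enum_val i)).
      rewrite [RHS](partition_big (fun i => enum_val i) predT)//=; apply: eq_bigr => x _.
      by rewrite scaler_suml; apply: eq_bigr => i /eqP->.
    apply/rowP => a; rewrite -kM summxE mxE; apply: eq_bigr => i _.
    by rewrite !mxE.
  have zs x : w x = 0 -> z x = 0.
    move=> wx; rewrite /z big_pred0// => i; apply/eqP => ix.
    by have := enum_valP i; rewrite ix inE wx eqxx.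
  have zx : z (enum_val j0) != 0.
    by rewrite /z (big_pred1 j0)// => i; exact: inj_eq enum_val_inj _ _.
  case: (ltgtP (z (enum_val j0)) 0) zx => // h _; last first.
    by exists z; split=> //; exists (enum_val j0).
  exists (fun x => - z x); split=> [|x /zs ->|]; last 1 first.
  - by exists (enum_val j0); rewrite oppr_gt0.
  - by under eq_bigr do rewrite scaleNr; rewrite sumrN zp oppr0.
  - by rewrite oppr0.
(* The ratio test: [x1] is the first weight to reach zero. *)
case: (@arg_minP _ _ _ x0 (fun x => 0 < z x) (fun x => w x / z x) z0) => x1 z1 xmin.
pose w' x := w x - w x1 / z x1 * z x.
have w'0 x : 0 <= w' x.
  rewrite subr_ge0; have [zx|zx] := ltP 0 (z x); first by rewrite -ler_pdivlMr// xmin.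
  by apply: le_trans (w0 x); rewrite mulr_ge0_le0// divr_ge0// ltW.
have [|w2 [w20 w2p w2d]] := IHk w' _ w'0; last first.
  exists w2; split=> //; rewrite w2p /w'; under eq_bigr do rewrite scalerBl -scalerA.
  by rewrite sumrB -scaler_sumr zp scaler0 subr0.
rewrite -ltnS; apply: leq_trans wk; apply: proper_card; apply/fintype.properP; split.
  apply/fintype.subsetP => x; rewrite !inE; apply: contraNneq => wx.
  by rewrite /w' (zs x wx) mulr0 subr0 wx.
have w'x1 : w' x1 = 0 by rewrite /w' divfK ?subrr// gt_eqF.
exists x1; rewrite !inE ?w'x1 ?eqxx//.
by apply/eqP => /zs zx; rewrite zx ltxx in z1.
Qed.

End finite_dimension.

(** * John position *)

Section perturbation.
Variable R : realType.

(** The alternative restricted to a subset of the indices, with weights extended by zero; [P] will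
    select the contact points. *)
Lemma gordan_pred (J : finType) (P : pred J) d (p : J -> 'rV[R]_d) :
  (exists c : J -> R, [/\ forall j, 0 <= c j, forall j, c j != 0 -> P j, \sum_j c j = 1
    & \sum_j c j *: p j = 0])
  \/ (exists y, forall j, P j -> 0 < dot y (p j)).
Proof.
case: (gordan (fun i : 'I_#|P| => p (enum_val i))) => [[c [c0 c1 cp]]|[y py]]; last first.
  by right; exists y => j Pj; have := py (enum_rank_in Pj j); rewrite enum_rankK_in.
left; exists (fun j => \sum_(i | enum_val i == j) c i); split.
- by move=> j; exact: sumr_ge0.
- move=> j; apply: contraR => Pj; apply/eqP; apply: big_pred0 => i; apply/eqP => ij.
  by have := enum_valP i; rewrite ij; exact/negP.
- by rewrite -c1 [RHS](partition_big (fun i => enum_val i) predT).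
- rewrite -[RHS]cp [RHS](partition_big (fun i => enum_val i) predT)//=; apply: eq_bigr => j _.
  by rewrite scaler_suml; apply: eq_bigr => i /eqP->.
Qed.

Lemma finite_pos_lower_bound (J : finType) (P : pred J) (e : J -> R) :
  (forall j, P j -> 0 < e j) -> exists2 d, 0 < d & forall j, P j -> d < e j.
Proof.
move=> e0; pose s := \sum_(j | P j) (e j)^-1.
have s0 : 0 <= s by apply: sumr_ge0 => j Pj; rewrite invr_ge0 ltW// e0.
have s1 : 0 < s + 1 by rewrite ltr_wpDl.
exists (s + 1)^-1; rewrite ?invr_gt0// => j Pj.
rewrite invf_plt ?posrE ?e0//; apply: (@le_lt_trans _ _ s); last by rewrite ltrDl.
by rewrite /s (bigD1 j)//= lerDl sumr_ge0// => i /andP[Pi _]; rewrite invr_ge0 ltW// e0.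
Qed.

(** A constraint survives a small perturbation if it is slack, or if it is tight and its first-order
    term is negative. *)
Lemma near0_quadratic_le0 (al ka mu : R) : al < 0 \/ al = 0 /\ ka < 0 ->
  \forall t \near 0^'+, al + t * (ka + t * mu) <= 0.
Proof.
have cts (a b : R) : (fun t : R => a + t * b) @ 0^'+ --> a.
  apply: cvg_at_right_filter.
  have cf : continuous (fun t : R => a + t * b).
    apply: continuous_fun_add; first exact: cst_continuous.
    by apply: continuous_fun_mul; [move=> t; exact: cvg_id|exact: cst_continuous].
  have : (fun t : R => a + t * b) @ 0 --> a + 0 * b := cf 0.
  by rewrite mul0r addr0.
case=> [al0|[-> ka0]]; near=> t.
  have t0 : 0 < t by near: t; exact: nbhs_right_gt.
  have t1 : t < 1 by near: t; apply: nbhs_right_lt; exact: ltr01.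
  have : al + t * (`|ka| + `|mu|) < 0 by near: t; apply: (cvgr_lt _ (cts _ _)); exact: al0.
  have h : ka + t * mu <= `|ka| + `|mu|.
    apply: lerD; first exact: ler_norm.
    apply: le_trans (_ : `|t * mu| <= _); first exact: ler_norm.
    by rewrite normrM (gtr0_norm t0) ler_piMl// ltW.
  by have := ler_wpM2l (ltW t0) h; lra.
have t0 : 0 < t by near: t; exact: nbhs_right_gt.
have h : ka + t * mu < 0 by near: t; apply: (cvgr_lt _ (cts _ _)); exact: ka0.
by rewrite add0r pmulr_rle0// ltW.
Unshelve. all: by end_near. Qed.

(** The product is the determinant of a triangular perturbation of the identity, whose derivative at
    0 is the trace. *)
Lemma near0_prod_gt1 n (x : 'I_n -> R) : 0 < \sum_k x k ->
  \forall t \near 0^'+, 1 < \prod_k (1 + t * x k).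
Proof.
have expand m (y : 'I_m -> R) : exists2 q : R -> R, continuous q &
    forall t, \prod_k (1 + t * y k) = 1 + t * (\sum_k y k) + t ^+ 2 * q t.
  elim: m y => [|m IHm] y.
    exists (cst 0); first exact: cst_continuous.
    by move=> t; rewrite !big_ord0 mulr0 mulr0 !addr0.
  have [q cq qE] := IHm (fun k => y (lift ord0 k)).
  pose s := \sum_k y (lift ord0 k).
  exists (fun t => q t + (y ord0 * s + t * (y ord0 * q t))).
    have cid : continuous (fun t : R => t) by move=> t; exact: cvg_id.
    apply: (continuous_fun_add cq); apply: continuous_fun_add; first exact: cst_continuous.
    apply: (continuous_fun_mul cid); apply: (fun h => continuous_fun_mul h cq).
    exact: cst_continuous.
  by move=> t; rewrite !big_ord_recl qE -/s; ring.
move=> s0; case: (expand n x) => q cq qE.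
have ch : (fun t => \sum_k x k + t * q t) @ 0^'+ --> \sum_k x k.
  apply: cvg_at_right_filter.
  have cf : continuous (fun t : R => \sum_k x k + t * q t).
    apply: continuous_fun_add; first exact: cst_continuous.
    by apply: continuous_fun_mul cq => t; exact: cvg_id.
  have : (fun t : R => \sum_k x k + t * q t) @ 0 --> \sum_k x k + 0 * q 0 := cf 0.
  by rewrite mul0r addr0.
near=> t; have t0 : 0 < t by near: t; exact: nbhs_right_gt.
have h : 0 < \sum_k x k + t * q t by near: t; apply: (cvgr_gt _ ch); exact: s0.
rewrite qE (_ : _ + _ + _ = 1 + t * (\sum_k x k + t * q t)); last by ring.
by rewrite ltrDl mulr_gt0.
Unshelve. all: by end_near. Qed.

End perturbation.

Section john_dual.
Variable R : realType.

Lemma dot_row_mx n1 n2 (a c : 'rV[R]_n1) (b d : 'rV[R]_n2) :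
  dot (row_mx a b) (row_mx c d) = dot a c + dot b d.
Proof.
by rewrite /dot big_split_ord; congr (_ + _); apply: eq_bigr => i _;
  rewrite ?row_mxEl ?row_mxEr.
Qed.

Lemma dot_mxvec n1 n2 (A B : 'M[R]_(n1, n2)) :
  dot (mxvec A) (mxvec B) = \sum_i \sum_j A i j * B i j.
Proof.
rewrite pair_bigA /dot (reindex _ (curry_mxvec_bij _ _)) /=.
by apply: eq_bigr => -[i j] _ /=; rewrite !mxvecE.
Qed.

(** John's condition for the unit ball, with weights normalized to mass 1. Only charged indices must
    be contact points, as the other facets may lie off the ball. *)
Definition decomposes_identity n m (u : 'I_m -> 'rV[R]_n) (c : 'I_m -> R) :=
  [/\ forall i, 0 <= c i, \sum_i c i = 1, forall i, c i != 0 -> dot (u i) (u i) = 1,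
    forall p q, \sum_i c i * (u i 0 p * u i 0 q) = (p == q)%:R / n%:R
    & forall p, \sum_i c i * u i 0 p = 0].

(* The ellipsoids [b + B (1 + G)] contained in the polytope of the [u i] are
   compared with the unit ball [B]; perturbations by lower triangular [G] suffice
   since the tensors [u i (x) u i] are symmetric. *)
Lemma john_dual n m (u : 'I_m -> 'rV[R]_n) : (0 < n)%N ->
  (forall i, dot (u i) (u i) <= 1) ->
  (forall (b : 'rV_n) (G : 'M[R]_n), (forall i, dot b (u i) <= 1) ->
    (forall i, dot (u i *m (1%:M + G)^T) (u i *m (1%:M + G)^T) <= (1 - dot b (u i)) ^+ 2) ->
    \det (1%:M + G) <= 1) ->
  exists c, decomposes_identity u c.
Proof.
move=> n0 u1 umax; have nn0 : n%:R != 0 :> R by rewrite pnatr_eq0 -lt0n.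
pose q i := \matrix_(k < n, l < n)
  if (l <= k)%N then u i 0 k * u i 0 l - (k == l)%:R / n%:R else 0.
pose p i := row_mx (u i) (mxvec (q i)).
(* A convex combination of the [p i] that vanishes is exactly the desired decomposition. Otherwise
   the separating vector is turned into a motion of the ball that increases its volume inside the
   polytope. *)
case: (gordan_pred (fun i => dot (u i) (u i) == 1) p) => [[c [c0 cP c1 cp]]|[y yp]].
  have E i : c i *: p i = row_mx (c i *: u i) (c i *: mxvec (q i)) by rewrite scale_row_mx.
  have lcp : \sum_i c i *: u i = 0.
    transitivity (lsubmx (\sum_i c i *: p i)); last by rewrite cp linear0.
    by rewrite linear_sum; apply: eq_bigr => i _; rewrite E /= row_mxKl.
  have rcp : \sum_i c i *: q i = 0.
    transitivity (vec_mx (rsubmx (\sum_i c i *: p i))); last by rewrite cp !linear0.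
    by rewrite !linear_sum; apply: eq_bigr => i _; rewrite E /= row_mxKr linearZ /= mxvecK.
  have iso (k l : 'I_n) : (l <= k)%N -> \sum_i c i * (u i 0 k * u i 0 l) = (k == l)%:R / n%:R.
    move=> lk; have /matrixP/(_ k l) := rcp; rewrite summxE mxE.
    under eq_bigr do rewrite !mxE lk mulrBr.
    by rewrite sumrB -mulr_suml c1 mul1r => /eqP; rewrite subr_eq0 => /eqP.
  exists c; split=> //.
  - by move=> i /cP/eqP.
  - move=> k l; have [lk|/ltnW kl] := leqP l k; first exact: iso.
    by rewrite eq_sym -iso//; apply: eq_bigr => i _; rewrite [u i 0 k * _]mulrC.
  - by move=> k; have /rowP/(_ k) := lcp; rewrite summxE [RHS]mxE => h; rewrite -[RHS]h;
    apply: eq_bigr => i _; rewrite mxE.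
exfalso; have [b [Y yE]] : exists b Y, y = row_mx b (mxvec Y).
  by exists (lsubmx y), (vec_mx (rsubmx y)); rewrite vec_mxK hsubmxK.
pose tau := (\sum_k Y k k) / n%:R.
pose L := \matrix_(k < n, l < n) if (l <= k)%N then Y k l else 0.
have quadE (G : 'M[R]_n) (x : 'rV_n) : dot x (x *m G^T) = \sum_k \sum_l G k l * (x 0 k * x 0 l).
  apply: eq_bigr => k _; rewrite mxE mulr_sumr; apply: eq_bigr => l _.
  by rewrite mxE; ring.
have dotyp i : dot y (p i) = dot b (u i) + (dot (u i) (u i *m L^T) - tau).
  rewrite yE dot_row_mx dot_mxvec quadE; congr (_ + _).
  rewrite /tau mulr_suml -sumrB; apply: eq_bigr => k _.
  transitivity (\sum_l (L k l * (u i 0 k * u i 0 l) - Y k l * ((k == l)%:R / n%:R))).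
    apply: eq_bigr => l _; rewrite !mxE; case: leqP => [_|kl]; first by ring.
    by rewrite (_ : k == l = false) ?mul0r ?mulr0 ?subr0//; apply/negbTE; rewrite neq_ltn kl.
  rewrite sumrB; congr (_ - _); rewrite (bigD1 k)//= eqxx mul1r big1 ?addr0// => l lk.
  by rewrite eq_sym (negPf lk) mul0r mulr0.
have [de de0 dey] := finite_pos_lower_bound yp.
(* The multiple of the identity makes the trace n [de], which is positive, so the determinant grows.
   On a contact point the first-order term is [de] minus the separation value, hence still
   negative. *)
pose G0 := - L + (tau + de)%:M.
pose be i := dot (- b) (u i); pose ga i := dot (u i) (u i *m G0^T).
have gaE i : dot (u i) (u i) = 1 -> ga i + be i < 0.
  move=> ui; have := dey i (introT eqP ui); rewrite dotyp /ga /be /G0 raddfD /= mulmxDr dotDr.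
  rewrite raddfN /= mulmxN dotNr dotNl tr_scalar_mx mul_mx_scalar dotZr ui mulr1; lra.
have trG0 : 0 < \sum_k G0 k k.
  under eq_bigr do rewrite !mxE leqnn eqxx mulr1n /=.
  rewrite big_split sumrN /= sumr_const card_ord -mulr_natr mulrDl /tau divfK//.
  by rewrite addrA addNr add0r mulr_gt0// ltr0n.
have near1 : \forall t \near 0^'+, forall i,
    -1 + t * (be i + t * 0) <= 0.
  by apply: filter_forall => i; apply: near0_quadratic_le0; left; rewrite ltrN10.
have near2 : \forall t \near 0^'+, forall i, dot (u i) (u i) - 1 +
    t * (2 * (ga i + be i) + t * (dot (u i *m G0^T) (u i *m G0^T) - be i ^+ 2)) <= 0.
  apply: filter_forall => i; apply: near0_quadratic_le0.
  have := u1 i; rewrite le_eqVlt => /predU1P[ui|ui]; last by left; rewrite subr_lt0.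
  by right; rewrite ui subrr; split=> //; rewrite pmulr_rlt0// gaE.
have near3 := near0_prod_gt1 trG0.
have [t [[t1 t2] t3]] := filter_ex (filterI (filterI near1 near2) near3).
have := umax (t *: - b) (t *: G0).
have -> : \det (1%:M + t *: G0) = \prod_k (1 + t * G0 k k).
  rewrite det_trig => [|]; first by apply: eq_bigr => k _; rewrite !mxE eqxx mulr1n.
  apply/is_trig_mxP => k l kl; rewrite !mxE leqNgt kl /=.
  have -> : (k == l) = false by apply/negbTE; rewrite neq_ltn kl.
  by rewrite !mulr0n oppr0 !add0r mulr0.
rewrite leNgt t3 => H; suff : false by []; apply: H => i; rewrite dotZl -/(be i).
  by have := t1 i; rewrite mulr0 addr0; lra.
have -> : u i *m (1%:M + t *: G0)^T = u i + t *: (u i *m G0^T).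
  by rewrite raddfD /= trmx1 linearZ /= mulmxDr mulmx1 scalemxAr.
rewrite !(dotDl, dotDr, dotZl, dotZr) (dotC (u i *m _) (u i)) -/(ga i).
by have := t2 i; move: (dot (u i *m _) _) => X; rewrite expr2; nra.
Qed.

End john_dual.

Section john_position.
Variable R : realType.

(** The ellipsoid a + B A is chosen of maximal determinant in the polytope, which exists by
    compactness. Pulling it back to the unit ball B turns the constraint of [v i] into that of
    [u i], and maximality is the hypothesis of [john_dual]. *)
Lemma john_position n m (v : 'I_m -> 'rV[R]_n) (rho : R) : (0 < n)%N ->
  (forall x, (forall i, dot x (v i) <= 1) -> forall k, - rho <= x 0 k <= rho) ->
  exists a (A : 'M[R]_n) u c, [/\ A \in unitmx, forall i, dot a (v i) < 1,
    forall i, v i *m A^T = (1 - dot a (v i)) *: u i,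
    forall i, dot (u i) (u i) <= 1 & decomposes_identity u c].
Proof.
move=> n0 bnd.
pose sq (A : 'M[R]_n) i := dot (v i *m A^T) (v i *m A^T).
(* The points a + y A with |y| <= 1 satisfy the i-th constraint iff |v i A^T| <= 1 - dot a (v i).
   Squaring makes the condition polynomial in the entries, hence closed. *)
pose feas (a : 'rV[R]_n) A := forall i, dot a (v i) <= 1 /\ sq A i <= (1 - dot a (v i)) ^+ 2.
pose pa (x : 'rV[R]_(n + n * n)) : 'rV[R]_n := lsubmx x.
pose pA (x : 'rV[R]_(n + n * n)) : 'M[R]_n := vec_mx (rsubmx x).
pose C := [set x | feas (pa x) (pA x)].
have cpa i : continuous (fun x => pa x 0 i).
  rewrite (_ : (fun _ => _) = (fun x : 'rV[R]_(n + n * n) => x 0 (lshift _ i))).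
    exact: coord_continuous.
  by apply/funext => x; rewrite mxE.
have cpA i j : continuous (fun x => pA x i j).
  rewrite (_ : (fun _ => _) = (fun x : 'rV[R]_(n + n * n) => x 0 (rshift n (mxvec_index i j)))).
    exact: coord_continuous.
  by apply/funext => x; rewrite !mxE.
have cdot i : continuous (fun x => dot (pa x) (v i)).
  apply: continuous_fun_sum => k; apply: continuous_fun_mul => //; exact: cst_continuous.
have csq i : continuous (fun x => sq (pA x) i).
  have ce k : continuous (fun x => (v i *m (pA x)^T) 0 k).
    rewrite (_ : (fun _ => _) = (fun x => \sum_l v i 0 l * pA x k l)).
      by apply: continuous_fun_sum => l; apply: continuous_fun_mul => //; exact: cst_continuous.
    by apply/funext => x; rewrite mxE; apply: eq_bigr => l _; rewrite mxE.
  by apply: continuous_fun_sum => k; exact: continuous_fun_mul.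
have cdet : continuous (fun x => \det (pA x)).
  apply: continuous_fun_sum => s; apply: continuous_fun_mul; first exact: cst_continuous.
  exact: continuous_fun_prod.
have clC : closed C.
  rewrite (_ : C = \bigcap_(i : 'I_m) ([set x | dot (pa x) (v i) <= 1] `&`
      [set x | sq (pA x) i <= (1 - dot (pa x) (v i)) * (1 - dot (pa x) (v i))])).
    apply: closed_bigI => i _; apply: closedI; apply: closed_fun_le => //.
      exact: cst_continuous.
    have c1 : continuous (fun x => 1 - dot (pa x) (v i)).
      by apply: continuous_fun_add; [exact: cst_continuous|exact: continuous_fun_opp].
    exact: continuous_fun_mul.
  apply/seteqP; split=> x; first by move=> h i _; have [] := h i; split; rewrite -?expr2.
  by move=> h i; have [] := h i I; rewrite /= -expr2.
have bC x : C x -> forall i, - (2 * rho) <= x 0 i <= 2 * rho.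
  move=> Cx; have ba := bnd (pa x) (fun i => (Cx i).1).
  move=> i; rewrite -[x]hsubmxK -/(pa x) -[rsubmx x]vec_mxK -/(pA x).
  case: (split_ordP i) => j ->; first by rewrite row_mxEl; have := ba j; lra.
  rewrite row_mxEr; case/mxvec_indexP: j => k l; rewrite mxvecE.
  (* The center plus a row of the matrix is a point of the ellipsoid, hence of the bounded polytope;
     the entries of the matrix are thus at most 2 rho in absolute value. *)
  have : forall i, dot (pa x + row k (pA x)) (v i) <= 1.
    move=> {}i; have [h1 h2] := Cx i; rewrite dotDl.
    suff : dot (row k (pA x)) (v i) <= 1 - dot (pa x) (v i) by lra.
    have -> : dot (row k (pA x)) (v i) = (v i *m (pA x)^T) 0 k.
      by rewrite mxE; apply: eq_bigr => r _; rewrite !mxE mulrC.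
    set e := (v i *m (pA x)^T) 0 k; set s := 1 - dot _ _ in h2 *.
    have s0 : 0 <= s by rewrite subr_ge0.
    have e2 : e ^+ 2 <= s ^+ 2.
      apply: le_trans h2; rewrite /sq /dot (bigD1 k)//= -expr2 lerDl.
      by apply: sumr_ge0 => j _; rewrite -expr2 sqr_ge0.
    by rewrite leNgt; apply/negP => se; move: e2; rewrite leNgt ltrXn2r ?nnegrE// ?(le_trans s0) ?ltW.
  by move=> /bnd/(_ l); rewrite mxE [row k _ _ _]mxE; have := ba l; lra.
have enc a A : pa (row_mx a (mxvec A)) = a /\ pA (row_mx a (mxvec A)) = A.
  by rewrite /pa /pA row_mxKl row_mxKr mxvecK.
(* A radius for which the centered ball fits in the polytope; it shows that [C] is nonempty and that
   the maximal determinant is positive. *)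
pose e := (1 + \sum_i dot (v i) (v i))^-1.
have s0 : 0 <= \sum_i dot (v i) (v i) by apply: sumr_ge0 => i _; exact: dot_ge0.
have e0 : 0 < e by rewrite invr_gt0 ltr_wpDr.
have Ce : C (row_mx 0 (mxvec e%:M)).
  move=> i; rewrite (enc _ _).1 (enc _ _).2 dot0l; split=> //; rewrite subr0 expr1n /sq.
  rewrite tr_scalar_mx mul_mx_scalar dotZl dotZr.
  have vi : e * dot (v i) (v i) <= 1.
    rewrite mulrC ler_pdivrMr ?mul1r ?ltr_wpDr//.
    apply: (@le_trans _ _ (\sum_i dot (v i) (v i))); last by rewrite lerDr.
    by rewrite (bigD1 i)//= lerDl sumr_ge0// => j _; exact: dot_ge0.
  apply: le_trans vi; rewrite ler_piMl// ?mulr_ge0 ?dot_ge0 ?(ltW e0)//.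
  by rewrite /e invf_le1 ?ltr_wpDr// lerDl.
have [x Cx xmax] := bounded_EVT_max (ex_intro _ _ Ce) clC bC cdet.
set a := pa x in Cx; set A := pA x in Cx xmax.
have dA : 0 < \det A.
  apply: lt_le_trans (xmax _ Ce); rewrite (enc _ _).2 det_scalar exprn_gt0//.
have uA : A \in unitmx by rewrite unitmxE unitfE gt_eqF.
have a1 i : dot a (v i) < 1.
  have [h1 h2] := Cx i; rewrite lt_neqAle h1 andbT; apply/eqP => h.
  have [v0|v0] := eqVneq (v i) 0; first by move/eqP: h; rewrite v0 dotC dot0l eq_sym oner_eq0.
  have : 0 < sq A i.
    apply: dot_gt0; apply: contraNneq v0 => vA.
    by rewrite -[v i](mulmxK (_ : A^T \in unitmx)) ?unitmx_tr// vA mul0mx.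
  by rewrite ltNge => /negP; apply; apply: le_trans h2 _; rewrite h subrr expr0n.
pose u i := (1 - dot a (v i))^-1 *: (v i *m A^T).
have r0 i : 0 < 1 - dot a (v i) by rewrite subr_gt0.
have uE i : v i *m A^T = (1 - dot a (v i)) *: u i.
  by rewrite /u scalerA divff ?scale1r// gt_eqF.
have u1 i : dot (u i) (u i) <= 1.
  have [_] := Cx i; rewrite /sq uE dotZl dotZr mulrA -expr2 -[leRHS]mulr1 ler_pM2l//.
  by rewrite exprn_gt0.
exists a, A, u; have [|c cu] := @john_dual R n m u n0 u1; last by exists c.
(* A competitor (b, 1 + G) of the unit ball pulls back to (a + b A, (1 + G) A), whose determinant is
   compared with that of [A]. *)
move=> b G hb hG; have := xmax (row_mx (a + b *m A) (mxvec ((1%:M + G) *m A))).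
rewrite (enc _ _).2 det_mulmx ger_pMl//; apply => i; rewrite (enc _ _).1.
have dE : dot (b *m A) (v i) = (1 - dot a (v i)) * dot b (u i).
  by rewrite dot_mulmx uE dotZr.
have hi : 1 - dot (a + b *m A) (v i) = (1 - dot a (v i)) * (1 - dot b (u i)).
  by rewrite dotDl dE; ring.
split.
  by rewrite -subr_ge0 hi mulr_ge0 ?subr_ge0// ltW.
rewrite hi /sq trmx_mul mulmxA uE -scalemxAl dotZl dotZr mulrA -expr2 exprMn.
by rewrite ler_pM2l ?exprn_gt0.
Qed.

End john_position.

(** * Finite families *)

Section helly_polytope.
Variable R : realType.

Lemma rmeasurable_polytope n (J : finType) (v : J -> 'rV[R]_n) :
  rmeasurable (\bigcap_(j in [set: J]) halfspace (v j)).
Proof. by apply: rmeasurable_bigcap_fin => j; exact: rmeasurable_dot_le. Qed.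

Lemma dot_le1 n (x y : 'rV[R]_n) (s : R) : 0 <= s ->
  dot x x <= s ^+ 2 -> dot y y <= 1 -> dot x y <= s.
Proof.
move=> s0 xs y1; rewrite leNgt; apply/negP => sxy.
have : s ^+ 2 < dot x y ^+ 2 by rewrite ltrXn2r ?nnegrE// ?(le_trans s0) ?(ltW sxy).
rewrite ltNge => /negP; apply; apply: le_trans (dot_cauchy x y) _.
by apply: le_trans xs; rewrite ler_piMr ?dot_ge0.
Qed.

Lemma helly_john_position n m (u : 'I_m -> 'rV[R]_n) (c : 'I_m -> R) : (0 < n)%N ->
  (forall j, dot (u j) (u j) <= 1) -> decomposes_identity u c ->
  exists (s : nat) (i : 'I_s -> 'I_m), (s <= n + n.+1)%N /\
    (volume (\bigcap_(k in [set: 'I_s]) halfspace (u (i k))) <=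
      (helly_constant R n)%:E * volume (\bigcap_(j in [set: 'I_m]) halfspace (u j)))%E.
Proof.
move=> n0 u1 [c0 c1 cu ciso ccenter].
have [f []] := exists_selection n0 c0 c1 cu ciso ccenter.
set U := \matrix_(k, p) _; set sk := \sum_k u (f k) => D2 s2.
have nn0 : 0 < n%:R :> R by rewrite ltr0n.
pose s := Num.sqrt (dot sk sk).
have s0 : 0 <= s by exact: sqrtr_ge0.
have ss : s ^+ 2 = dot sk sk by rewrite sqr_sqrtr// dot_ge0.
have D0 : 0 < `|\det U|.
  rewrite normr_gt0 -sqrf_eq0 gt_eqF// (lt_le_trans _ D2)//.
  by rewrite divr_gt0 ?mulr_gt0 ?exprn_gt0 ?ltr0n ?fact_gt0.
(* These weights express [- sk] as a combination of the [u j] of total mass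
   [n * s]; being nonnegative, they can be supported on [n + 1] indices. *)
pose w j := n%:R * c j * (s - dot sk (u j)).
have w0 j : 0 <= w j by rewrite /w mulr_ge0 ?mulr_ge0// subr_ge0 dot_le1// ss.
(* The constant coordinate makes the reduction preserve the total mass, at the price of one more
   index. *)
pose p j : 'rV[R]_(n + 1) := row_mx (u j) 1%:M.
have [w' [w'0 w'p w'd]] := caratheodory p w0.
have skE (g : 'I_m -> R) : \sum_j g j *: p j = row_mx (\sum_j g j *: u j) (\sum_j g j)%:M.
  rewrite raddf_sum -[RHS]/(row_mx _ _).
  elim/big_rec3: _ => [|j a b d _ ->]; first by rewrite row_mx0.
  by rewrite scale_row_mx add_row_mx scale_scalar_mx mulr1.
have wu : \sum_j w j *: u j = - sk.
  apply/rowP => q; rewrite summxE mxE.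
  transitivity (n%:R * s * (\sum_j c j * u j 0 q) -
      n%:R * \sum_r sk 0 r * (\sum_j c j * (u j 0 r * u j 0 q))).
    under [X in _ - _ * X]eq_bigr do rewrite mulr_sumr.
    rewrite exchange_big /= !mulr_sumr -sumrB; apply: eq_bigr => j _.
    rewrite mxE /w /dot mulrBr mulrBl; congr (_ - _); first by ring.
    rewrite mulr_sumr mulr_suml mulr_sumr; apply: eq_bigr => r _; ring.
  rewrite ccenter mulr0 sub0r; congr (- _); under eq_bigr do rewrite ciso.
  rewrite (bigD1 q)//= eqxx big1 ?addr0 => [|r /negPf->]; last by rewrite mul0r mulr0.
  by rewrite mul1r mulrCA divff ?mulr1// gt_eqF.
have wsum : \sum_j w j = n%:R * s.
  rewrite /w; under eq_bigr do rewrite mulrBr.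
  rewrite sumrB -mulr_suml -mulr_sumr c1 mulr1 (_ : \sum_j _ = 0) ?subr0//.
  transitivity (n%:R * dot sk (\sum_j c j *: u j)).
    by rewrite dot_sumr mulr_sumr; apply: eq_bigr => j _; rewrite dotZr mulrA.
  rewrite (_ : \sum_j _ = 0) ?(dotC _ 0) ?dot0l ?mulr0//.
  by apply/rowP => q; rewrite summxE mxE -[RHS](ccenter q); apply: eq_bigr => j _; rewrite mxE.
have [w'u w's] : \sum_j w' j *: u j = - sk /\ \sum_j w' j = n%:R * s.
  have /eq_row_mx[h1 h2] : row_mx (\sum_j w' j *: u j) (\sum_j w' j)%:M =
      row_mx (- sk) (n%:R * s)%:M :> 'rV_(n + 1).
    by rewrite -skE w'p skE wu wsum.
  by split=> //; have /matrixP/(_ 0 0) := h2; rewrite !mxE.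
pose T := [pred j | w' j != 0].
pose i (k : 'I_(n + #|T|)) : 'I_m :=
  match fintype.split k with inl a => f a | inr b => enum_val b end.
exists (n + #|T|)%N, i; split; first by rewrite leq_add2l -addn1.
have [b [b0 Vb _ bG]] := ball_Gamma R n0.
have Kb : (b%:E <= volume (\bigcap_(j in [set: 'I_m]) halfspace (u j)))%E.
  rewrite -Vb; apply: le_volume; [exact: rmeasurable_open_ball|exact: rmeasurable_polytope|].
  move=> y y1 j _; rewrite /halfspace /=; apply: dot_le1 => //.
  by rewrite expr1n ltW.
have hK : (n%:R * (1 + s)) ^+ n / n`!%:R <= `|\det U| * (helly_constant R n * b).
  apply: helly_constant_ball => //; first by rewrite ss.
  by rewrite real_normK ?num_real.
have K0 := helly_constant_gt0 R n0.
set Q := \bigcap_(k in _) _.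
apply: (@le_trans _ _ ((helly_constant R n)%:E * b%:E)%E); last first.
  by rewrite lee_wpmul2l// lee_fin ltW.
(* The slacks [1 - dot y (u (f k))] map the polytope into a corner simplex. *)
pose M := - U^T; pose S := @corner_simplex R n (n%:R * (1 + s)).
have r0 : 0 <= n%:R * (1 + s) by rewrite mulr_ge0 ?addr_ge0// ltW.
have uM : M \in unitmx.
  by rewrite unitmxE unitfE /M -scaleN1r detZ mulf_neq0// ?signr_eq0// det_tr -normr_gt0.
have detM : `|\det M| = `|\det U|.
  by rewrite /M -scaleN1r detZ normrM normrX normrN1 expr1n mul1r det_tr.
have := affine_scaling_unitmx (const_mx 1) uM (@rmeasurable_corner_simplex R n (n%:R * (1 + s))).
rewrite volume_corner_simplex// detM => VS.
have QS : Q `<=` [set x | S (x *m M + const_mx 1)].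
  move=> y Qy.
  have yf k : dot y (u (f k)) <= 1.
    have := Qy (lshift _ k) I; rewrite /halfspace /= /i.
    by rewrite (unsplitK (inl k : 'I_n + 'I_#|T|)).
  have yT j : w' j != 0 -> dot y (u j) <= 1.
    move=> Tj; have := Qy (rshift _ (enum_rank_in (Tj : j \in T) j)) I.
    rewrite /halfspace /= /i (unsplitK (inr (enum_rank_in _ j) : 'I_n + 'I_#|T|)).
    by rewrite enum_rankK_in.
  have tE k : (y *m M + const_mx 1) 0 k = 1 - dot y (u (f k)).
    rewrite !mxE addrC; congr (1 + _); rewrite -sumrN; apply: eq_bigr => l _.
    by rewrite !mxE mulrN.
  split=> [k|]; first by rewrite tE subr_ge0.
  under eq_bigr do rewrite tE.
  (* The slacks add up to n - dot y sk, which is n plus the combination of the [dot y (u j)] with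
     weights [w'], so at most n + n s. *)
  rewrite sumrB -dot_sumr -/sk sumr_const card_ord -[sk]opprK -w'u dotNr dot_sumr opprK.
  rewrite mulrDr mulr1 lerD2l -w's; apply: ler_sum => j _; rewrite dotZr.
  by have [->|wj] := eqVneq (w' j) 0; [rewrite mul0r|rewrite ler_piMr// yT].
have VQ : (`|\det U|%:E * volume Q <= (`|\det U| * (helly_constant R n * b))%:E)%E.
  apply: (@le_trans _ _ (`|\det U|%:E * volume [set x | S (x *m M + const_mx 1)%R])%E).
    apply: lee_wpmul2l; first by rewrite lee_fin.
    apply: le_volume QS; first exact: rmeasurable_polytope.
    exact: (rmeasurable_affine _ _ (rmeasurable_corner_simplex _)).
  rewrite -VS lee_fin; exact: hK.
by rewrite -EFinM -(@lee_pmul2l _ `|\det U|%:E)// -EFinM.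
Qed.

(** The map y |-> y A + a carries the half-space of [u j] onto that of [v j], because 1 - dot a (v
    j) is positive. Both volumes scale by |det A|. *)
Lemma helly_polytope n m (v : 'I_m -> 'rV[R]_n) (rho : R) : (0 < n)%N ->
  (forall x, (forall j, dot x (v j) <= 1) -> forall k, - rho <= x 0 k <= rho) ->
  exists (s : nat) (i : 'I_s -> 'I_m), (s <= n + n.+1)%N /\
    (volume (\bigcap_(k in [set: 'I_s]) halfspace (v (i k))) <=
      (helly_constant R n)%:E * volume (\bigcap_(j in [set: 'I_m]) halfspace (v j)))%E.
Proof.
move=> n0 bnd; have [a [A [u [c [uA a1 uE u1 cu]]]]] := john_position n0 bnd.
have [s [i [sn V]]] := helly_john_position n0 u1 cu.
have scale (J : finType) (g : J -> 'I_m) :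
    volume (\bigcap_(k in [set: J]) halfspace (v (g k))) =
    (`|\det A|%:E * volume (\bigcap_(k in [set: J]) halfspace (u (g k))))%E.
  rewrite (affine_scaling_unitmx a uA (rmeasurable_polytope _)).
  congr (_ * volume _)%E; apply/seteqP.
  have E y j : halfspace (v j) (y *m A + a) <-> halfspace (u j) y.
    rewrite /halfspace /= dotDl (_ : dot (y *m A) (v j) = (1 - dot a (v j)) * dot y (u j)).
      have a0 : 0 < 1 - dot a (v j) by rewrite subr_gt0.
      by rewrite -(ler_pM2l a0 (dot y (u j)) 1) mulr1 lerBrDr.
    by rewrite dot_mulmx uE dotZr.
  by split=> y h k _; apply/E; exact: h.
exists s, i; split=> //; rewrite (scale _ i) (scale _ id) muleCA.
by apply: lee_wpmul2l V; rewrite lee_fin.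
Qed.

End helly_polytope.

(** * Reduction to finite families *)

Section finite_reduction.
Variable R : realType.

Lemma lt_bound_norm (x : R) : x < (Num.bound `|x|)%:R.
Proof. exact: le_lt_trans (ler_norm x) (archi_boundP (normr_ge0 x)). Qed.

Lemma volume_nonincreasing_cvg n (A : nat -> set 'rV[R]_n) :
  (forall k, rmeasurable (A k)) -> (forall k l, (k <= l)%N -> A l `<=` A k) ->
  (volume (A 0%N) < +oo)%E ->
  volume (A k) @[k --> \oo] --> volume (\bigcap_k A k).
Proof.
move=> mA dA A0.
have := @nonincreasing_cvg_mu _ _ _ (@lebesgue_tuple R n) (fun k => @row_of_tuple R n @^-1` A k).
rewrite -preimage_bigcap; apply => //; first exact: rmeasurable_bigcap_nat.
by move=> k l kl; apply/subsetPset => t; exact: dA.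
Qed.

Lemma volume_translate n (A : set 'rV[R]_n) (b : 'rV_n) : rmeasurable A ->
  volume A = volume [set x | A (x + b)].
Proof.
move=> mA; rewrite (affine_scaling_unitmx b (unitmx1 _ _) mA) det1 normr1 mul1e.
by congr volume; apply/funext => x /=; rewrite mulmx1.
Qed.

(* The parts [D r] of [P] beyond height [r] in direction [y] have a volume that
   does not decrease with [r], by translation, yet tends to 0. *)
Lemma volume_recession n (P : set 'rV[R]_n) (y : 'rV_n) : rmeasurable P -> y != 0 ->
  (forall x, P x -> P (x + y)) -> (volume P < +oo)%E -> volume P = 0%E.
Proof.
move=> mP y0 Py Pfin; have yy := dot_gt0 y0.
pose D (r : R) := P `&` [set x | dot x (- y) <= - r].
have DE r x : D r x <-> P x /\ r <= dot x y by rewrite /D /= dotNr lerN2.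
have mD r : rmeasurable (D r) by apply: rmeasurableI => //; exact: rmeasurable_dot_le.
have D_shift r : (volume (D r) <= volume (D (r + dot y y)%R))%E.
  rewrite [leRHS](volume_translate y (mD _)); apply: le_volume => //.
    have := rmeasurable_affine 1%:M y (mD (r + dot y y)).
    by congr rmeasurable; apply/funext => x /=; rewrite mulmx1.
  move=> x /DE[Px rx]; apply/DE; split; first exact: Py.
  by rewrite dotDl lerD2r.
have D_shiftn r k : (volume (D r) <= volume (D (r + k%:R * dot y y)%R))%E.
  elim: k => [|k IHk]; first by rewrite mul0r addr0.
  by apply: le_trans IHk (le_trans (D_shift _) _); rewrite -addrA -natr1 mulrDl mul1r.
have D_fin r : (volume (D r) < +oo)%E.
  by apply: le_lt_trans Pfin; apply: le_volume => // x [].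
have D0 r : volume (D r) = 0%E.
  have cv : volume (D (r + k%:R * dot y y)) @[k --> \oo] -->
      volume (\bigcap_k D (r + k%:R * dot y y)).
    apply: volume_nonincreasing_cvg => // k l kl x /DE[Px h]; apply/DE; split=> //.
    by apply: le_trans h; rewrite lerD2l ler_wpM2r ?ler_nat// ltW.
  have cap0 : \bigcap_k D (r + k%:R * dot y y) = set0.
    apply/seteqP; split=> // x h.
    have /DE[_] := h (Num.bound `|(dot x y - r) / dot y y|) I.
    by rewrite leNgt -ltrBlDl -ltr_pdivrMr// lt_bound_norm.
  have v0 : volume (@set0 'rV[R]_n) = 0%E := measure0 (@lebesgue_tuple R n).
  apply/eqP; rewrite eq_le volume_ge0 andbT leNgt; apply/negP => Dr.
  rewrite cap0 v0 in cv.
  have near_lt : \forall k \near \oo, (volume (D (r + k%:R * dot y y)%R) < volume (D r))%E.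
    exact: cv _ (open_ereal_lt' Dr).
  have [k] := filter_ex near_lt.
  by rewrite ltNge => /negP; apply; exact: D_shiftn.
have PD : P = \bigcup_k D (- k%:R).
  apply/seteqP; split=> [x Px|x [k _ /DE[]//]].
  exists (Num.bound `|- dot x y|) => //; apply/DE; split=> //.
  by rewrite lerNl ltW// lt_bound_norm.
apply/eqP; rewrite eq_le volume_ge0 andbT.
have : (@lebesgue_tuple R n).-negligible (@row_of_tuple R n @^-1` P).
  rewrite PD preimage_bigcup; apply: negligible_bigcup => k.
  by apply/negligibleP; [exact: mD|exact: D0].
by move/negligibleP => /(_ mP) h; rewrite (_ : volume P = 0%E)//.
Qed.

End finite_reduction.

(** * Countable subfamilies and bounded finite intersections *)

Section subfamilies.
Variable R : realType.

(* [e] enumerates, for every mesh [k.+1^-1] and every cell [z] of the lattice of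
   that mesh, a member of the family lying in the cell, if there is one. *)
Lemma countable_subfamily n (I : Type) (i0 : I) (v : I -> 'rV[R]_n) :
  exists e : nat -> I, forall x, (forall k, dot x (v (e k)) <= 1) ->
    forall i, dot x (v i) <= 1.
Proof.
pose cell (k : nat) (i : I) : {ffun 'I_n -> int} := [ffun l => Num.floor (k.+1%:R * v i 0 l)].
have /choice[sel selP] : forall kz : nat * {ffun 'I_n -> int}, exists i0',
    (exists i, cell kz.1 i = kz.2) -> cell kz.1 i0' = kz.2.
  move=> kz; have [[i h]|h] := pselect (exists i, cell kz.1 i = kz.2).
    by exists i.
  by exists i0 => /h.
exists (fun j => if unpickle j is Some kz then sel kz else i0) => x xe i.
rewrite leNgt; apply/negP => xi.
pose s := \sum_l `|x 0 l|.
(* The mesh is fine enough that replacing [v i] by the chosen member of its cell changes the inner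
   product with x by less than the excess dot x (v i) - 1. *)
pose k := Num.bound `|s / (dot x (v i) - 1)|.
have d0 : 0 < dot x (v i) - 1 by rewrite subr_gt0.
have sk : s < k.+1%:R * (dot x (v i) - 1).
  rewrite -ltr_pdivrMr//; apply: lt_trans (lt_bound_norm _) _; by rewrite ltr_nat.
pose i' := sel (k, cell k i).
have cE : cell k i' = cell k i by apply: (selP (k, cell k i)); exists i.
have xi' : dot x (v i') <= 1.
  by have := xe (pickle (k, cell k i)); rewrite pickleK.
have k0 : 0 < k.+1%:R :> R by rewrite ltr0n.
have vv l : `|k.+1%:R * v i 0 l - k.+1%:R * v i' 0 l| <= 1.
  have /ffunP/(_ l) := cE; rewrite !ffunE => fE.
  have /andP[a1 a2] := floor_itv (k.+1%:R * v i 0 l).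
  have /andP[b1 b2] := floor_itv (k.+1%:R * v i' 0 l).
  move: a2 b2; rewrite fE in b1 *; rewrite !intrD => a2 b2.
  by rewrite ler_norml; apply/andP; split; lra.
have : k.+1%:R * (dot x (v i) - dot x (v i')) <= s.
  rewrite -dotNr -dotDr /dot mulr_sumr; apply: ler_sum => l _.
  rewrite mulrCA !mxE mulrBr; apply: le_trans (ler_norm _) _.
  by rewrite normrM ler_piMr.
apply/negP; rewrite -ltNge; apply: lt_le_trans sk _.
by rewrite ler_pM2l// lerD2l lerN2.
Qed.

(** Compactness of the unit sphere: if no finite stage worked, unit vectors with dot (y m) (w k) <=
    1/(m + 1) for all k < m would accumulate at a unit vector having nonpositive product with every
    [w k]. *)
Lemma bounded_subpolytope n (w : nat -> 'rV[R]_n) :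
  (forall y, y != 0 -> exists k, 0 < dot y (w k)) ->
  exists m rho, forall x, (forall k, (k < m)%N -> dot x (w k) <= 1) ->
    forall l, - rho <= x 0 l <= rho.
Proof.
move=> wpos.
have coord (x : 'rV[R]_n) (t : R) : 0 <= t -> dot x x <= t ^+ 2 -> forall l, - t <= x 0 l <= t.
  move=> t0 xt l; rewrite -ler_norml -(@ler_pXn2r _ 2)// ?nnegrE// real_normK ?num_real//.
  apply: le_trans xt; rewrite /dot (bigD1 l)//= -expr2 lerDl.
  by apply: sumr_ge0 => j _; rewrite -expr2 sqr_ge0.
have [m mP] : exists m, forall y, dot y y = 1 ->
    exists2 k, (k < m)%N & m.+1%:R^-1 < dot y (w k).
  apply: contrapT => H.
  have /choice[y yP] : forall m, exists y, dot y y = 1 /\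
      forall k, (k < m)%N -> dot y (w k) <= m.+1%:R^-1.
    move=> m; apply: contrapT => h; apply: H; exists m => y y1.
    apply: contrapT => hy; apply: h; exists y; split=> // k km.
    by rewrite leNgt; apply/negP => hk; apply: hy; exists k.
  have cdot u : continuous (fun x : 'rV[R]_n => dot x u).
    apply: continuous_fun_sum => i; apply: continuous_fun_mul; last exact: cst_continuous.
    exact: coord_continuous.
  have csq : continuous (fun x : 'rV[R]_n => dot x x).
    by apply: continuous_fun_sum => i; apply: continuous_fun_mul; exact: coord_continuous.
  pose S := [set x : 'rV[R]_n | dot x x <= 1] `&` [set x | 1 <= dot x x].
  have clS : closed S.
    by apply: closedI; apply: closed_fun_le => //; exact: cst_continuous.
  have cS : compact S.
    apply: (subclosed_compact clS (@rV_compact _ n (fun=> `[- 1 : R, 1 : R]%classic) _)).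
      by move=> _; exact: segment_compact.
    move=> x [x1 _] i /=; rewrite in_itv/=; apply: coord => //.
    by rewrite expr1n.
  have [z [[_ z1] zcl]] : S `&` cluster (y @ \oo) !=set0.
    by apply: cS; exists 0%N => //= m _; rewrite /S /=; have [-> _] := yP m.
  have z0 : z != 0.
    by apply: contraTneq z1 => ->; rewrite dot0l ler10.
  have [k zk] := wpos z z0.
  have cl : closed [set x | dot x (w k) <= dot z (w k) / 2].
    by apply: closed_fun_le => //; exact: cst_continuous.
  have : [set x | dot x (w k) <= dot z (w k) / 2] z.
    apply: cl => B zB; apply: zcl zB.
    suff : \forall m \near \oo, dot (y m) (w k) <= dot z (w k) / 2 by [].
    near=> m; have [_ /(_ k) h] := yP m.
    have km : (k < m)%N by near: m; exact: nbhs_infty_gt.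
    apply: le_trans (h km) _.
    have hm : (dot z (w k) / 2)^-1 < m%:R by near: m; exact: nbhs_infty_gtr.
    rewrite invf_ple ?posrE ?divr_gt0// ltW// (lt_trans hm)// ltr_nat//.
  by rewrite /= leNgt => /negP; apply; lra.
(* In a unit direction whose product with some [w k] exceeds 1/(m + 1), the constraint stops the ray
   before distance m + 1. *)
exists m, m.+1%:R => x xw; apply: coord => //.
have [->|x0] := eqVneq x 0; first by rewrite dot0l sqr_ge0.
pose t := Num.sqrt (dot x x).
have t0 : 0 < t by rewrite sqrtr_gt0 dot_gt0.
have tt : t ^+ 2 = dot x x by rewrite sqr_sqrtr// dot_ge0.
have [|k km] := mP (t^-1 *: x).
  by rewrite dotZl dotZr -tt expr2 mulKf ?mulVf// gt_eqF.
rewrite dotZl => h; rewrite -tt lerXn2r ?nnegrE// ?ltW//.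
have := lt_le_trans h (_ : _ <= t^-1 * 1); rewrite ler_pM2l ?invr_gt0// => /(_ (xw k km)).
by rewrite mulr1 ltf_pV2 ?posrE.
Unshelve. all: by end_near. Qed.

End subfamilies.

Section family.
Variable R : realType.

Lemma gammad_gt1 (d : R) : 1 < d -> 1 < gammad d.
Proof.
move=> d1; have s1 : 1 < Num.sqrt d by rewrite -sqrtr1 ltr_sqrt// (lt_trans ltr01).
rewrite /gammad exprn_egt1// ltr_pdivlMr ?mul1r; lra.
Qed.

Lemma helly_family n (T : Type) (v : T -> 'rV[R]_n) (g : R) : (0 < n)%N -> 1 < g ->
  (0 < volume (\bigcap_(i in [set: T]) halfspace (v i)))%E ->
  exists (s : nat) (i : 'I_s -> T), (s <= n + n.+1)%N /\
    (volume (\bigcap_(k in [set: 'I_s]) halfspace (v (i k))) <=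
      (g * helly_constant R n)%:E * volume (\bigcap_(i in [set: T]) halfspace (v i)))%E.
Proof.
move=> n0 g1; set P := \bigcap_(i in _) _ => P0.
have K0 := helly_constant_gt0 R n0.
have g0 : 0 < g by rewrite (lt_trans ltr01).
have [Poo|Poo] := eqVneq (volume P) +oo%E.
  (* The right-hand side is infinite, so the empty selection will do. *)
  have i : 'I_0 -> T by case.
  by exists 0%N, i; split=> //; rewrite Poo gt0_muley ?leey// lte_fin mulr_gt0.
have Pfin : (volume P < +oo)%E by rewrite ltey.
have no_recession y : y != 0 -> (forall x, P x -> P (x + y)) -> rmeasurable P -> False.
  by move=> y0 Py mP; move: P0; rewrite (volume_recession mP y0 Py Pfin) ltxx.
have [[i0 _]|noI] := pselect (exists i : T, True); last first.
  (* An empty family leaves the whole space, which is invariant under every translation and so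
     cannot have finite positive volume. *)
  have PT : P = setT by apply/seteqP; split=> // x _ i; case: noI; exists i.
  exfalso; apply: (@no_recession (const_mx 1)); rewrite ?PT//; last exact: measurableT.
  by apply/eqP => /rowP/(_ (Ordinal n0)); rewrite !mxE => /eqP; rewrite oner_eq0.
have [e eP] := countable_subfamily i0 v.
pose w k := v (e k).
have PE : P = \bigcap_k halfspace (w k).
  by apply/seteqP; split=> x xP i _; [exact: xP|apply: eP => k; exact: xP].
have mP : rmeasurable P.
  by rewrite PE; apply: rmeasurable_bigcap_nat => k; exact: rmeasurable_dot_le.
(* A direction with nonpositive product with every [w k] would be a recession direction of [P]. *)
have wpos y : y != 0 -> exists k, 0 < dot y (w k).
  move=> y0; apply: contrapT => h; apply: (no_recession y y0) => // x; rewrite PE => Px k _.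
  rewrite /halfspace /= dotDl; have := Px k I; rewrite /halfspace /= => xk.
  have : dot y (w k) <= 0; last by move=> yk; lra.
  by rewrite leNgt; apply/negP => yk; apply: h; exists k.
have [m [rho bnd]] := bounded_subpolytope wpos.
(* Starting from m members, every stage is bounded; the first one then has finite volume, as
   continuity from above requires. *)
pose A l := \bigcap_(j in [set: 'I_(m + l)]) halfspace (w j).
have mA l : rmeasurable (A l) by exact: rmeasurable_polytope.
have AE l x : A l x <-> forall k, (k < m + l)%N -> dot x (w k) <= 1.
  by split=> [h k kl|h k _]; [exact: (h (Ordinal kl) I)|exact: h].
have Abnd l x : A l x -> forall k, - rho <= x 0 k <= rho.
  by move=> /AE h; apply: bnd => k km; apply: h; rewrite (leq_trans km) ?leq_addr.
have A0 : (volume (A 0%N) < +oo)%E.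
  apply: (@le_lt_trans _ _ (volume
      [set x : 'rV[R]_n | forall i, - (`|rho| + 1) < x 0 i < `|rho| + 1])).
    apply: le_volume; [exact: mA|exact: rmeasurable_cube|].
    move=> x /Abnd h i; have := h i; have := ler_norm rho; lra.
  by rewrite volume_cube ?ltry// addr_ge0.
have cA : volume (A l) @[l --> \oo] --> volume P.
  rewrite (_ : P = \bigcap_l A l).
    apply: volume_nonincreasing_cvg => // k l kl x /AE h; apply/AE => j jk.
    by apply: h; rewrite (leq_trans jk)// leq_add2l.
  rewrite PE; apply/seteqP; split=> x h; first by move=> l _ k _; exact: h.
  move=> k _; have /AE := h k.+1 I; apply; by rewrite addnS ltnS leq_addl.
(* Here g > 1 and 0 < |P| < +oo leave room for a finite stage of volume below g |P|. *)
have Plt : (volume P < g%:E * volume P)%E.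
  move: P0 Pfin; case: (volume P) => // p; rewrite lte_fin => p0 _.
  by rewrite -EFinM lte_fin ltr_pMl.
have near_lt : \forall l \near \oo, (volume (A l) < g%:E * volume P)%E.
  exact: cA _ (open_ereal_lt' Plt).
have [l Al] := filter_ex near_lt.
have [|s [i [sn V]]] := @helly_polytope R n (m + l) (fun j => w j) rho n0.
  by move=> x h; apply: (Abnd l) => j _; exact: h.
exists s, (fun k => e (i k)); split=> //; apply: le_trans V _.
have gK (K : R) : (g * K)%:E = (K%:E * g%:E)%E by rewrite mulrC.
rewrite gK -muleA; apply: lee_wpmul2l; first by rewrite lee_fin ltW.
exact: ltW Al.
Qed.

End family.

Theorem theorem1p3 (R : realType) :
  exists C : R, 0 < C /\
  forall (n : nat), (1 <= n)%N ->
  forall (I : Type) (v : I -> 'rV[R]_n),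
  (0 < volume (\bigcap_(i in [set: I]) halfspace (v i)))%E ->
  forall d : R, 1 < d ->
  exists (s : nat) (i : 'I_s -> I),
    [/\ s%:R <= (d + 1) * (n%:R + 1),
        (volume (\bigcap_(k in [set: 'I_s]) halfspace (v (i k))) <=
          (gammad d `^ ((n%:R + 1) / 2) *
           (n%:R `^ (n%:R / 2) * (n%:R + 1) `^ (3 * (n%:R + 1) / 2) /
              (pi `^ (n%:R / 2) * n`!%:R)) *
           Gamma (n%:R / 2 + 1))%:E *
          volume (\bigcap_(i in [set: I]) halfspace (v i)))%E &
        ((gammad d `^ ((n%:R + 1) / 2) *
           (n%:R `^ (n%:R / 2) * (n%:R + 1) `^ (3 * (n%:R + 1) / 2) /
              (pi `^ (n%:R / 2) * n`!%:R)) *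
           Gamma (n%:R / 2 + 1))%:E *
          volume (\bigcap_(i in [set: I]) halfspace (v i)) <=
          (gammad d `^ ((n%:R + 1) / 2) * (C * n%:R) `^ (3 * n%:R / 2))%:E *
          volume (\bigcap_(i in [set: I]) halfspace (v i)))%E].
Proof.
exists 8; split=> // n n0 I v P0 d d1.
have c_eq : forall g : R, g * (n%:R `^ (n%:R / 2) * (n%:R + 1) `^ (3 * (n%:R + 1) / 2) /
    (pi `^ (n%:R / 2) * n`!%:R)) * Gamma (n%:R / 2 + 1) = g * helly_constant R n.
  by move=> g; rewrite -mulrA.
rewrite c_eq; set g := gammad d `^ _.
have g1 : 1 < g.
  have e0 : 0 < (n%:R + 1) / 2 :> R by rewrite divr_gt0// ltr_wpDl.
  have g0 : 0 <= gammad d by exact: sqr_ge0.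
  have := gt0_ltr_powR e0 _ _ (gammad_gt1 d1).
  by rewrite powR1; apply; rewrite nnegrE.
have [s [i [sn V]]] := helly_family n0 g1 P0.
exists s, i; split=> //.
  (* 2n + 1 <= 2(n + 1) <= (d + 1)(n + 1), as d > 1. *)
  apply: (@le_trans _ _ (n + n.+1)%:R); first by rewrite ler_nat.
  have : (0 : R) <= n%:R by [].
  by rewrite natrD -natr1; nra.
apply: lee_wpmul2r; first exact: ltW.
by rewrite lee_fin ler_pM2l ?(lt_trans ltr01)// helly_constant_le.
Qed.
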